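(* Let $\Omega\subset\mathbb{H}$ be a circular domain and let $g\in\mathcal{R}(\Omega)$ be such that $g$ has no non-real isolated zeroes and $g^s$ has a square root $\tau\in\mathcal{R}_{\mathbb{R}}(\Omega)\setminus\{0\}$ (i.e. $\tau^2=g^s$). Then $\tau^{-*}*g=g/\tau$ is a well-defined slice regular function on $\Omega$ (that is, the function $g/\tau$, defined outside the zero set of $\tau$, extends to a slice regular function on $\Omega$), and its symmetrized function is identically $1$: $(g/\tau)^s\equiv1$.
   Context: $\mathbb{H}$ is the algebra of quaternions; $q=q_0+q_v$ with $q_0$ real and $q_v$ purely imaginary, $q^c=q_0-q_v$, $\mathbb{S}=\{I\in\mathbb{H}: I^2=-1\}$, $\mathbb{C}_I=\mathbb{R}+\mathbb{R}I$, $\mathbb{S}_q=\{q_0+\|q_v\|J: J\in\mathbb{S}\}$, $\Omega_I=\Omega\cap\mathbb{C}_I$. A domain (nonempty connected open set) $\Omega\subset\mathbb{H}$ is circular if $\mathbb{S}_q\subset\Omega$ for all $q\in\Omega$. A function $f:\Omega\to\mathbb{H}$ is slice regular if $f(\alpha+I\beta)=F_0(\alpha+\sqrt{-1}\beta)+I F_1(\alpha+\sqrt{-1}\beta)$ for all $I\in\mathbb{S}$ and $\alpha,\beta\in\mathbb{R}$ with $\alpha+I\beta\in\Omega$, where $F_0,F_1:\{\alpha+\sqrt{-1}\beta:\alpha+I\beta\in\Omega\}\to\mathbb{H}$ are $C^1$, $F_0(\bar z)=F_0(z)$, $F_1(\bar z)=-F_1(z)$ and $\partial_\alpha F_0=\partial_\beta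 F_1$, $\partial_\beta F_0=-\partial_\alpha F_1$. $\mathcal{R}(\Omega)$ is the set of slice regular functions; $f\in\mathcal{R}(\Omega)$ is slice preserving if $f(\Omega_I)\subset\mathbb{C}_I$ for all $I\in\mathbb{S}$, and $\mathcal{R}_{\mathbb{R}}(\Omega)$ is the set of slice preserving functions. The $*$-product is $(f*g)(q)=0$ if $f(q)=0$, and $(f*g)(q)=f(q)\,g(f(q)^{-1}qf(q))$ otherwise; when $f$ is slice preserving it is the pointwise product. The slice conjugate $f^c$ is the function induced by $(F_0^c,F_1^c)$ (pointwise conjugates), and the symmetrized function is $f^s=f*f^c$. The $*$-inverse is $f^{-*}=(f^s)^{-1}f^c$, defined outside the zero set of $f^s\not\equiv0$; for $\tau$ slice preserving, $\tau^{-*}=\tau^{-1}$ pointwise. Non-real isolated zeroes: let $f\in\mathcal{R}(\Omega)$ with $f^s\not\equiv0$ and $q_0\in\Omega\setminus\mathbb{R}$. Write $f=\Delta^m\tilde f$ with $m\ge0$ the largest integer for which this is possible with $\tilde f\in\mathcal{R}(\Omega)$, where $\Delta(q)=q^2-2q\,\mathrm{Re}(q_0)+|q_0|^2$ (so $\tilde f\not\equiv0$ on $\mathbb{S}_{q_0}$). The point $q_0$ is a non-real isolated zero of $f$ if $\tilde f(q_0)=0$. *)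

(* Defs.v *)
From HB Require Import structures.
From mathcomp Require Import all_boot all_order all_algebra.
From mathcomp Require Import all_classical all_reals all_analysis.
From mathcomp Require Import ring lra.

Set Implicit Arguments.
Unset Strict Implicit.
Unset Printing Implicit Defensive.

Import Order.TTheory GRing.Theory Num.Theory.
Import numFieldNormedType.Exports.

Local Open Scope classical_set_scope.
Local Open Scope ring_scope.

(* The row (a, b, c, d) stands for a + b i + c j + d k. The topology and the
   real vector space structure are those of R^4; the norm `|q| inherited from
   'rV[R]_4 is the sup norm, NOT the Euclidean one, which is [qnorm]. *)
Definition quat (R : realType) : Type := 'rV[R]_4.

Section QuaternionAlgebra.
Variable R : realType.

HB.instance Definition _ := NormedModule.copy (quat R) 'rV[R]_4.

Implicit Types p q : quat R.

Definition mkquat (a b c d : R) : quat R :=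
  \row_(i < 4) nth 0 [:: a; b; c; d] i.

Definition qcoord q (i : nat) : R := (q : 'rV[R]_4) 0 (inord i).

Lemma qcoord_mk a b c d :
  (qcoord (mkquat a b c d) 0 = a) * (qcoord (mkquat a b c d) 1 = b) *
  (qcoord (mkquat a b c d) 2 = c) * (qcoord (mkquat a b c d) 3 = d).
Proof. by rewrite /qcoord /mkquat !mxE !inordK. Qed.

Lemma qcoordD p q i : qcoord (p + q) i = qcoord p i + qcoord q i.
Proof. by rewrite /qcoord mxE. Qed.

Lemma qcoordZ (a : R) q i : qcoord (a *: q) i = a * qcoord q i.
Proof. by rewrite /qcoord mxE. Qed.

Lemma qcoord0 i : qcoord 0 i = 0.
Proof. by rewrite /qcoord mxE. Qed.

Lemma quatP p q :
  qcoord p 0 = qcoord q 0 -> qcoord p 1 = qcoord q 1 ->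
  qcoord p 2 = qcoord q 2 -> qcoord p 3 = qcoord q 3 -> p = q.
Proof.
move=> h0 h1 h2 h3; apply/rowP => i.
rewrite -[i]inord_val; case: i => -[|[|[|[|//]]]] ? /=; assumption.
Qed.

Definition mulq p q : quat R :=
  let: (a, b, c, d) := (qcoord p 0, qcoord p 1, qcoord p 2, qcoord p 3) in
  let: (a', b', c', d') := (qcoord q 0, qcoord q 1, qcoord q 2, qcoord q 3) in
  mkquat (a * a' - b * b' - c * c' - d * d')
         (a * b' + b * a' + c * d' - d * c')
         (a * c' - b * d' + c * a' + d * b')
         (a * d' + b * c' - c * b' + d * a').

Definition oneq : quat R := mkquat 1 0 0 0.

Fact mulqA : associative mulq.
Proof. by move=> x y z; apply: quatP; rewrite !qcoord_mk; ring. Qed.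

Fact mul1q : left_id oneq mulq.
Proof. by move=> x; apply: quatP; rewrite !qcoord_mk; ring. Qed.

Fact mulq1 : right_id oneq mulq.
Proof. by move=> x; apply: quatP; rewrite !qcoord_mk; ring. Qed.

Fact mulqDl : left_distributive mulq +%R.
Proof.
by move=> x y z; apply: quatP; rewrite !(qcoordD, qcoord_mk); ring.
Qed.

Fact mulqDr : right_distributive mulq +%R.
Proof.
by move=> x y z; apply: quatP; rewrite !(qcoordD, qcoord_mk); ring.
Qed.

Fact oneq_neq0 : oneq != 0.
Proof.
apply/eqP => /(congr1 (fun q => qcoord q 0)).
by rewrite qcoord_mk qcoord0 => /eqP; rewrite oner_eq0.
Qed.

HB.instance Definition _ := GRing.Zmodule_isNzRing.Build (quat R)
  mulqA mul1q mulq1 mulqDl mulqDr oneq_neq0.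

Fact scaleqAl (a : R) p q : a *: (p * q) = (a *: p) * q.
Proof. by apply: quatP; rewrite !(qcoordZ, qcoord_mk); ring. Qed.

HB.instance Definition _ := GRing.Lmodule_isLalgebra.Build R (quat R) scaleqAl.

Fact scaleqAr (a : R) p q : a *: (p * q) = p * (a *: q).
Proof. by apply: quatP; rewrite !(qcoordZ, qcoord_mk); ring. Qed.

HB.instance Definition _ := GRing.Lalgebra_isAlgebra.Build R (quat R) scaleqAr.

Definition qre q : R := qcoord q 0.

Definition qim q : quat R := q - (qre q)%:A.

Definition qconj q : quat R := (qre q)%:A - qim q.

Definition qnorm q : R := Num.sqrt (\sum_(i < 4) qcoord q i ^+ 2).

Definition invq q : quat R :=
  if q == 0 then 0 else (qnorm q ^+ 2)^-1 *: qconj q.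

Lemma qnorm_sqr q : qnorm q ^+ 2 =
  qcoord q 0 ^+ 2 + qcoord q 1 ^+ 2 + qcoord q 2 ^+ 2 + qcoord q 3 ^+ 2.
Proof.
rewrite sqr_sqrtr; last by apply: sumr_ge0 => i _; exact: sqr_ge0.
by rewrite !big_ord_recr big_ord0 /= add0r.
Qed.

Lemma qnorm_eq0 q : (qnorm q ^+ 2 == 0) = (q == 0).
Proof.
apply/eqP/eqP => [|->]; last by rewrite qnorm_sqr !qcoord0; ring.
rewrite qnorm_sqr => h.
have sq0 (x : R) : x ^+ 2 <= 0 -> x = 0.
  by move=> x0; apply/eqP; rewrite -sqrf_eq0 eq_le x0 sqr_ge0.
have := sqr_ge0 (qcoord q 0); have := sqr_ge0 (qcoord q 1).
have := sqr_ge0 (qcoord q 2); have := sqr_ge0 (qcoord q 3) => h3 h2 h1 h0.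
by apply: quatP; rewrite qcoord0; apply: sq0; lra.
Qed.

Lemma qcoord_conj q : qconj q =
  mkquat (qcoord q 0) (- qcoord q 1) (- qcoord q 2) (- qcoord q 3).
Proof.
have N p i : qcoord (- p) i = - qcoord p i by rewrite /qcoord mxE.
by apply: quatP;
   rewrite /qconj /qim /qre !(qcoordD, N, qcoordZ, qcoord_mk); ring.
Qed.

Fact mulVq : {in [pred q : quat R | q != 0], left_inverse 1 invq *%R}.
Proof.
move=> q; rewrite inE => q0; rewrite /invq (negbTE q0) qcoord_conj.
have : qnorm q ^+ 2 != 0 by rewrite qnorm_eq0.
rewrite qnorm_sqr => n0.
by apply: quatP; rewrite !(qcoordZ, qcoord_mk); field.
Qed.

Fact mulqV : {in [pred q : quat R | q != 0], right_inverse 1 invq *%R}.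
Proof.
move=> q; rewrite inE => q0; rewrite /invq (negbTE q0) qcoord_conj.
have : qnorm q ^+ 2 != 0 by rewrite qnorm_eq0.
rewrite qnorm_sqr => n0.
by apply: quatP; rewrite !(qcoordZ, qcoord_mk); field.
Qed.

Fact unitqP p q : q * p = 1 /\ p * q = 1 -> p != 0.
Proof.
by case=> qp1 _; apply: contra_eq_neq qp1 => ->; rewrite mulr0 eq_sym oner_eq0.
Qed.

Fact invq_out : {in [predC [pred q : quat R | q != 0]], invq =1 id}.
Proof.
by move=> q; rewrite inE negbK => /eqP ->; rewrite /invq eqxx.
Qed.

HB.instance Definition _ := GRing.NzRing_hasMulInverse.Build (quat R)
  mulVq mulqV unitqP invq_out.

End QuaternionAlgebra.

Section SliceRegular.
Variable R : realType.

Implicit Types (q I J : quat R) (Omega : set (quat R)).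
Implicit Types (f g h : quat R -> quat R) (F : R * R -> quat R).

Definition imag_units : set (quat R) := [set I | I ^+ 2 = -1].

(* The complex number alpha + sqrt(-1) beta is the pair z = (alpha, beta). *)
Definition slice_pt I (z : R * R) : quat R := z.1%:A + z.2 *: I.

Definition slice_plane I : set (quat R) := range (slice_pt I).

Definition sphere_of q : set (quat R) :=
  [set (qre q)%:A + qnorm (qim q) *: J | J in imag_units].

Definition circular Omega := forall q, Omega q -> sphere_of q `<=` Omega.

Definition circular_domain Omega :=
  [/\ Omega !=set0, open Omega, connected Omega & circular Omega].

Definition stem_dom Omega : set (R * R) :=
  [set z | exists2 I, imag_units I & Omega (slice_pt I z)].

Definition d_alpha F (z : R * R) : quat R := 'D_((1, 0) : R * R) F z.
Definition d_beta F (z : R * R) : quat R := 'D_((0, 1) : R * R) F z.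

(* Meant for an open set D, as is [stem_dom Omega] when Omega is open and
   circular: the partial derivatives exist and are continuous on D. *)
Definition C1_on (D : set (R * R)) F :=
  forall z, D z ->
    [/\ derivable F z ((1, 0) : R * R), derivable F z ((0, 1) : R * R),
        {for z, continuous (d_alpha F)} & {for z, continuous (d_beta F)}].

(* F0 and F1 are total functions of which only the restrictions to
   [stem_dom Omega] matter. *)
Definition regular_stem Omega (F0 F1 : R * R -> quat R) :=
  [/\ C1_on (stem_dom Omega) F0, C1_on (stem_dom Omega) F1,
      forall z, stem_dom Omega z ->
        F0 (z.1, - z.2) = F0 z /\ F1 (z.1, - z.2) = - F1 z
    & forall z, stem_dom Omega z ->
        d_alpha F0 z = d_beta F1 z /\ d_beta F0 z = - d_alpha F1 z].

Definition induced_by Omega (F0 F1 : R * R -> quat R) f :=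
  forall I z, imag_units I -> Omega (slice_pt I z) ->
    f (slice_pt I z) = F0 z + I * F1 z.

Definition slice_regular Omega f :=
  exists F0 F1 : R * R -> quat R, regular_stem Omega F0 F1 /\ induced_by Omega F0 F1 f.

Definition slice_preserving Omega f :=
  slice_regular Omega f /\
  forall I, imag_units I -> f @` (Omega `&` slice_plane I) `<=` slice_plane I.

Definition star f g q : quat R :=
  if f q == 0 then 0 else f q * g ((f q)^-1 * q * f q).

(* The function f^c, determined on Omega by f; it is unspecified off
   Omega, and if f is not slice regular on Omega. *)
Definition slice_conj Omega f : quat R -> quat R :=
  xget f [set h | exists F0 F1,
    [/\ regular_stem Omega F0 F1, induced_by Omega F0 F1 f
      & induced_by Omega (qconj (R:=R) \o F0) (qconj (R:=R) \o F1) h]].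

Definition symmetrized Omega f : quat R -> quat R :=
  star f (slice_conj Omega f).

(* Meaningful outside the zero set of [symmetrized Omega f]. *)
Definition star_inv Omega f q : quat R :=
  (symmetrized Omega f q)^-1 * slice_conj Omega f q.

Definition Delta q0 q : quat R :=
  q ^+ 2 - (2 * qre q0) *: q + (qnorm q0 ^+ 2)%:A.

Definition Delta_factor Omega q0 f (m : nat) (ft : quat R -> quat R) :=
  slice_regular Omega ft /\
  forall q, Omega q -> f q = Delta q0 q ^+ m * ft q.

Definition nonreal_isolated_zero Omega f q0 :=
  [/\ exists2 q, Omega q & symmetrized Omega f q != 0,
      Omega q0, qim q0 != 0
    & exists m ft,
        [/\ Delta_factor Omega q0 f m ft,
            forall m' ft', Delta_factor Omega q0 f m' ft' -> (m' <= m)%N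
          & ft q0 = 0]].

(* h extends to Omega the pointwise quotient g / tau, where tau is slice
   preserving; the side on which one divides matters. *)
Definition regular_quotient Omega g tau h :=
  slice_regular Omega h /\
  forall q, Omega q -> tau q != 0 -> h q = (tau q)^-1 * g q.

End SliceRegular.

(* Main.v *)
Require Import Defs.
From HB Require Import structures.
From mathcomp Require Import all_boot all_order all_algebra.
From mathcomp Require Import all_classical all_reals all_analysis.
From mathcomp Require Import ring lra complex.

Import Order.TTheory GRing.Theory Num.Theory.
Import numFieldNormedType.Exports.
Import Normc.

Local Open Scope classical_set_scope.
Local Open Scope ring_scope.
Local Open Scope complex_scope.

(** A slice regular function is given by a stem, a function with values in the
   complexified quaternions whose four coordinates [G k] are ordinary holomorphic
   functions on the stem domain, commuting with conjugation.  The star product is the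
   product of stems ([star_stem]), so that the symmetrized function of [g] has the
   complex-valued stem [nform G], the sum of the squares of the [G k]
   ([symmetrizedE]).  A slice preserving function has a complex-valued stem [t]
   ([slice_preserving_real]).  The hypothesis becomes [nform G = t ^+ 2], and the claim
   is that [t] divides every [G k]; the quotients [H k] then satisfy [nform H = 1] off
   the zeroes of [t], hence everywhere.

   The zeroes of [t] are isolated: by [identity_theorem] the function [t] does not
   vanish identically near any point, so that it has a finite order [p] at each point.
   Divisibility is local ([glue_quotient]) and is checked at each zero [c] of [t].

   If [c] is real, all the functions are real on the real axis near [c], where
   [t ^+ 2] is a sum of squares; each [G k] is bounded by [t] there, and vanishes to the
   order [p] at least ([division_real]).

   If [c] is not real, write [g = Delta ^+ m * f] with [m] as large as possible.  If
   the norm form of [f] vanished at [c], then [f] would vanish at a point of the sphere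
   of [c] ([null_stem]), which would be a non-real isolated zero.  So [nform G] has the
   order [2 * m] at [c], and [p = m] is at most the order of every [G k]
   ([division_nonreal]).

   The function theory that this needs is the division by [z - c] of a holomorphic
   function vanishing at [c], and the identity theorem on discs.  Both follow from
   Cauchy's formula, obtained here as a limit of sums over roots of unity
   ([discrete_cauchy]).  Holomorphy is taken in the form of strict differentiability,
   in which the difference quotient converges as both of its points move; it is
   equivalent to the Cauchy-Riemann equations for functions of class C1 ([CR_sdiff],
   [hol_regular_stem]), is uniform on compact sets ([uniform_sdiff]), and passes to
   limits whose difference quotients are equicontinuous ([division0]). *)

Set Implicit Arguments.
Unset Strict Implicit.
Unset Printing Implicit Defensive.

(** * The modulus of a complex number *)

Section Modulus.
Variable R : realType.
Implicit Types x y z : R[i].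

Lemma normc_ge0 z : 0 <= normc z.
Proof. by case: z => a b; exact: sqrtr_ge0. Qed.

Lemma normc_sqr z : normc z ^+ 2 = complex.Re z ^+ 2 + complex.Im z ^+ 2.
Proof. by case: z => a b /=; rewrite sqr_sqrtr // addr_ge0 ?sqr_ge0. Qed.

Lemma normc_eq0 z : (normc z == 0) = (z == 0).
Proof. by apply/eqP/eqP => [/eq0_normc|->]; rewrite ?normc0. Qed.

Lemma normc_gt0 z : (0 < normc z) = (z != 0).
Proof. by rewrite lt_def normc_ge0 normc_eq0 andbT. Qed.

Lemma ler_normcD x y : normc (x + y) <= normc x + normc y.
Proof. exact: le_normcD. Qed.

Lemma normc_opp x : normc (- x) = normc x.
Proof. exact: normcN. Qed.

Lemma ler_normcB x y : normc (x - y) <= normc x + normc y.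
Proof. by rewrite -[normc y]normc_opp; exact: ler_normcD. Qed.

Lemma distcC x y : normc (x - y) = normc (y - x).
Proof. by rewrite -normc_opp opprB. Qed.

Lemma ler_distc y x z : normc (x - z) <= normc (x - y) + normc (y - z).
Proof.
have -> : x - z = (x - y) + (y - z) by ring.
exact: ler_normcD.
Qed.

Lemma normcX z n : normc (z ^+ n) = normc z ^+ n.
Proof. by elim: n => [|n ih]; rewrite ?expr0 ?normc1 // !exprS normcM ih. Qed.

Lemma normc_real (t : R) : normc t%:C = `|t|.
Proof. by rewrite /= expr0n addr0 sqrtr_sqr. Qed.

Lemma normc_Re z : `|complex.Re z| <= normc z.
Proof.
rewrite -(ler_pXn2r (ltn0Sn 1)) ?nnegrE ?normr_ge0 ?normc_ge0 //.
by rewrite normc_sqr real_normK ?num_real // lerDl sqr_ge0.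
Qed.

Lemma normc_Im z : `|complex.Im z| <= normc z.
Proof.
rewrite -(ler_pXn2r (ltn0Sn 1)) ?nnegrE ?normr_ge0 ?normc_ge0 //.
by rewrite normc_sqr real_normK ?num_real // lerDr sqr_ge0.
Qed.

Lemma normc_le_ReIm z : normc z <= `|complex.Re z| + `|complex.Im z|.
Proof.
rewrite -(ler_pXn2r (ltn0Sn 1)) ?nnegrE ?addr_ge0 ?normc_ge0 //.
rewrite normc_sqr sqrrD !real_normK ?num_real // addrAC lerDl.
by rewrite mulrn_wge0 ?mulr_ge0.
Qed.

Lemma normc_conj z : normc z^* = normc z.
Proof. by case: z => a b /=; rewrite sqrrN. Qed.

Lemma ler_normc_sum (I : Type) (s : seq I) (P : pred I) (F : I -> R[i]) :
  normc (\sum_(i <- s | P i) F i) <= \sum_(i <- s | P i) normc (F i).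
Proof.
elim/big_rec2: _ => [|i y x _ le_xy]; first by rewrite normc0.
by apply: le_trans (ler_normcD _ _) _; rewrite lerD2l.
Qed.

Lemma normc_small_eq0 z : (forall e, 0 < e -> normc z <= e) -> z = 0.
Proof.
move=> small; apply/eqP; rewrite -normc_eq0 eq_le normc_ge0 andbT.
by apply/ler_addgt0Pl => e e0; rewrite addr0 small.
Qed.

End Modulus.

(** * Limits of complex-valued functions *)

Section ComplexLimits.
Variable R : realType.
Local Notation C := R[i].

(** Closeness is measured by the modulus with values in the ordered field [R],
   and the filter is arbitrary: points, pairs of points and integers tending to
   infinity are then covered by the same algebra of limits. *)
Definition clim (T : Type) (F : set_system T) (f : T -> C) (l : C) :=
  forall e, 0 < e -> F [set x | normc (f x - l) <= e].

Section LimitAlgebra.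
Variables (T : Type) (F : set_system T).
Context {FF : Filter F}.
Implicit Types (f g : T -> C) (a b l : C).

Lemma clim_cst l : clim F (fun=> l) l.
Proof. by move=> e e0; apply: filterE => x /=; rewrite subrr normc0 ltW. Qed.

Lemma clim_near f g l : F [set x | f x = g x] -> clim F f l -> clim F g l.
Proof.
by move=> fg fl e e0; apply: filterS2 fg (fl e e0) => x /= ->.
Qed.

Lemma climD f g a b : clim F f a -> clim F g b ->
  clim F (fun x => f x + g x) (a + b).
Proof.
move=> fa gb e e0; have h0 : 0 < e / 2 by lra.
apply: filterS2 (fa _ h0) (gb _ h0) => x /= h1 h2.
have -> : f x + g x - (a + b) = (f x - a) + (g x - b) by ring.
by apply: le_trans (ler_normcD _ _) _; lra.
Qed.

Lemma climM f g a b : clim F f a -> clim F g b ->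
  clim F (fun x => f x * g x) (a * b).
Proof.
move=> fa gb e e0; pose M := normc a + normc b + 1.
have M0 : 0 < M by rewrite /M; have := normc_ge0 a; have := normc_ge0 b; lra.
have h0 : 0 < e / M by rewrite divr_gt0.
apply: filterS3 (fa _ h0) (gb _ h0) (gb _ ltr01) => x /= h1 h2 h3.
have -> : f x * g x - a * b =
  (f x - a) * (g x - b) + (f x - a) * b + a * (g x - b) by ring.
apply: le_trans (ler_normcD _ _) _.
apply: le_trans (lerD (ler_normcD _ _) (lexx _)) _; rewrite !normcM.
have -> : e = e / M * 1 + e / M * normc b + normc a * (e / M).
  by rewrite /M in M0 *; field; rewrite gt_eqF.
by rewrite !lerD ?ler_pM ?normc_ge0.
Qed.

Lemma climV f a : a != 0 -> clim F f a -> clim F (fun x => (f x)^-1) a^-1.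
Proof.
move=> a0 fa e e0; have na : 0 < normc a by rewrite normc_gt0.
have h0 : 0 < normc a / 2 by lra.
have h1 : 0 < e * (normc a * (normc a / 2)) by rewrite !mulr_gt0.
apply: filterS2 (fa _ h0) (fa _ h1) => x /= k0 k1.
have fx : normc a / 2 <= normc (f x).
  have := ler_normcB (f x - (f x - a)) 0; have := ler_normcB (f x) (f x - a).
  by rewrite opprB addrC subrK normc0; lra.
have fx0 : 0 < normc (f x) by lra.
have fxn : f x != 0 by rewrite -normc_gt0.
have -> : (f x)^-1 - a^-1 = - (f x - a) * (f x * a)^-1.
  by field; rewrite a0 fxn.
rewrite normcM normcV normc_opp normcM ler_pdivrMr ?mulr_gt0 //.
apply: le_trans k1 _; rewrite ler_pM2l // mulrC.
by rewrite ler_pM2r.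
Qed.

Lemma climX f a n : clim F f a -> clim F (fun x => f x ^+ n) (a ^+ n).
Proof.
move=> fa; elim: n => [|n ih]; first exact: clim_cst.
by rewrite exprS; apply: clim_near (climM fa ih); apply: filterE => x /=; rewrite exprS.
Qed.

Lemma clim_conj f a : clim F f a -> clim F (fun x => (f x)^*) a^*.
Proof. by move=> fa e /fa; apply: filterS => x /=; rewrite -rmorphB normc_conj. Qed.

End LimitAlgebra.

Lemma clim_unique (T : Type) (F : set_system T) {FF : ProperFilter F}
    (f : T -> C) a b : clim F f a -> clim F f b -> a = b.
Proof.
move=> fa fb; apply/subr0_eq/normc_small_eq0 => e e0.
have h0 : 0 < e / 2 by lra.
have [x [/= h1 h2]] := filter_ex (filterI (fa _ h0) (fb _ h0)).
by apply: le_trans (ler_distc (f x) _ _) _; rewrite distcC; lra.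
Qed.

Definition disc (a : C) (r : R) : set C := [set z | normc (z - a) < r].

Definition cnbhs (a : C) : set_system C :=
  [set P | exists2 r : R, 0 < r & disc a r `<=` P].

Global Instance cnbhs_filter a : ProperFilter (cnbhs a).
Proof.
apply: Build_ProperFilter_ex => [P [r r0 rP]|].
  by exists a; apply: rP; rewrite /disc /= subrr normc0.
split => [|P Q [r r0 rP] [s s0 sQ]|P Q PQ [r r0 rP]].
- by exists 1.
- exists (Num.min r s); first by rewrite lt_min r0.
  by move=> z; rewrite /disc /= lt_min => /andP[zr zs]; split; [exact: rP|exact: sQ].
- by exists r => // z /rP /PQ.
Qed.

Lemma disc_center a (r : R) : 0 < r -> disc a r a.
Proof. by rewrite /disc /= subrr normc0. Qed.

Lemma cnbhs_disc a (r : R) : 0 < r -> cnbhs a (disc a r).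
Proof. by move=> r0; exists r. Qed.

Lemma cnbhs_at a P : cnbhs a P -> P a.
Proof. by move=> [r r0]; apply; rewrite /disc /= subrr normc0. Qed.

Lemma cnbhs_near a P : cnbhs a P -> cnbhs a [set z | cnbhs z P].
Proof.
move=> [r r0 rP]; exists (r / 2); first by lra.
move=> z; rewrite /disc /= => za; exists (r / 2); first by lra.
move=> w; rewrite /disc /= => wz; apply: rP; rewrite /disc /=.
by apply: le_lt_trans (ler_distc z _ _) _; lra.
Qed.

(** The punctured neighbourhoods of a point. *)
Definition cdnbhs (a : C) : set_system C :=
  [set P | cnbhs a [set z | z != a -> P z]].

Global Instance cdnbhs_filter a : ProperFilter (cdnbhs a).
Proof.
apply: Build_ProperFilter_ex => [P [r r0 rP]|].
  have h0 : 0 < r / 2 by lra.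
  exists (a + (r / 2)%:C); apply: rP.
    by rewrite /disc /= addrAC subrr add0r normc_real gtr0_norm //; lra.
  by rewrite -subr_eq0 addrAC subrr add0r -normc_gt0 normc_real gtr0_norm.
split => [|P Q|P Q PQ].
- exact: (@filterE _ (cnbhs a)).
- by apply: (@filterS2 _ (cnbhs a)) => z /= zP zQ za; split; [exact: zP|exact: zQ].
- by apply: (@filterS _ (cnbhs a)) => z /= zP za; exact/PQ/zP.
Qed.

Lemma cdnbhs_neq a : cdnbhs a [set z | z != a].
Proof. by apply: (@filterE _ (cnbhs a)) => z za. Qed.

Lemma cdnbhs_le a P : cnbhs a P -> cdnbhs a P.
Proof. by apply: (@filterS _ (cnbhs a)) => z Pz _. Qed.

Lemma clim_dnbhs a (f : C -> C) l : clim (cnbhs a) f l -> clim (cdnbhs a) f l.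
Proof. by move=> fl e /fl /cdnbhs_le. Qed.

Definition ccont (f : C -> C) a := clim (cnbhs a) f (f a).

Lemma ccont_id a : ccont id a.
Proof. by move=> e e0; exists e => // z /ltW. Qed.

Lemma ccont_neq0 f a : ccont f a -> f a != 0 -> cnbhs a [set z | f z != 0].
Proof.
move=> fa fa0; have h0 : 0 < normc (f a) / 2 by rewrite divr_gt0 ?normc_gt0.
apply: filterS (fa _ h0) => z /=; apply: contraTneq => ->.
by rewrite sub0r normc_opp -ltNge; lra.
Qed.

Lemma ccont_eq_dnbhs f g a : ccont f a -> ccont g a ->
  cdnbhs a [set z | f z = g z] -> f a = g a.
Proof.
move=> fa ga fg; apply: (@clim_unique _ (cdnbhs a) _ g); last exact: clim_dnbhs.
exact: clim_near fg (clim_dnbhs fa).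
Qed.

End ComplexLimits.

Arguments clim_cst {R T} F {FF} l.

(** * Strict complex differentiability *)

Section StrictDerivative.
Variable R : realType.
Local Notation C := R[i].
Implicit Types (f g : C -> C) (a l : C).

(** The pairs of distinct points that are both close to [a]. *)
Definition offdiag (a : C) : set_system (C * C) :=
  [set P | exists2 r : R, 0 < r &
     forall z w, disc a r z -> disc a r w -> z != w -> P (z, w)].

Global Instance offdiag_filter a : ProperFilter (offdiag a).
Proof.
apply: Build_ProperFilter_ex => [P [r r0 rP]|].
  have h0 : 0 < r / 2 by lra.
  exists (a, a + (r / 2)%:C); apply: rP.
  - by rewrite /disc /= subrr normc0.
  - by rewrite /disc /= addrAC subrr add0r normc_real gtr0_norm //; lra.
  - rewrite eq_sym -subr_eq0 addrAC subrr add0r -normc_gt0 normc_real.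
    by rewrite gtr0_norm.
split => [|P Q [r r0 rP] [s s0 sQ]|P Q PQ [r r0 rP]].
- by exists 1.
- exists (Num.min r s); first by rewrite lt_min r0.
  move=> z w; rewrite /disc /= !lt_min => /andP[zr zs] /andP[wr ws] zw.
  by split; [exact: rP|exact: sQ].
- by exists r => // z w h1 h2 h3; apply/PQ/rP.
Qed.

(** The difference quotient is required to converge as both of its points tend to
   [a].  On an open set this means that a continuous complex derivative exists,
   but the uniform estimates that follow from it need no mean value inequality. *)
Definition sdiff f a l :=
  clim (offdiag a) (fun p => (f p.1 - f p.2) / (p.1 - p.2)) l.

Lemma offdiag_fst a P : cnbhs a P -> offdiag a [set p | P p.1].
Proof. by move=> [r r0 rP]; exists r => // z w zr _ _; apply: rP. Qed.

Lemma offdiag_snd a P : cnbhs a P -> offdiag a [set p | P p.2].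
Proof. by move=> [r r0 rP]; exists r => // z w _ wr _; apply: rP. Qed.

Lemma offdiag_neq a : offdiag a [set p | p.1 != p.2].
Proof. by exists 1. Qed.

Lemma sdiffP f a l : sdiff f a l <->
  forall e, 0 < e -> exists2 d : R, 0 < d & forall z w, disc a d z -> disc a d w ->
    normc (f z - f w - l * (z - w)) <= e * normc (z - w).
Proof.
split=> [fl e /fl [d d0 dP]|fl e /fl [d d0 dP]]; exists d => // z w zd wd.
- have [->|zw] := eqVneq z w; first by rewrite !subrr mulr0 subrr normc0 mulr0.
  have zw0 : z - w != 0 by rewrite subr_eq0.
  have := dP _ _ zd wd zw; rewrite /= -(ler_pM2r (_ : 0 < normc (z - w))) ?normc_gt0 //.
  by rewrite -normcM mulrBl divfK.
- move=> zw; have zw0 : z - w != 0 by rewrite subr_eq0.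
  rewrite /= -(ler_pM2r (_ : 0 < normc (z - w))) ?normc_gt0 //.
  by rewrite -normcM mulrBl divfK //; exact: dP.
Qed.

Lemma sdiff_near f g a l : cnbhs a [set z | f z = g z] -> sdiff f a l -> sdiff g a l.
Proof.
move=> fg; apply: clim_near.
by apply: filterS2 (offdiag_fst fg) (offdiag_snd fg) => p /= -> ->.
Qed.

Lemma sdiff_cont f a l : sdiff f a l -> ccont f a.
Proof.
move=> /sdiffP/(_ _ ltr01) [d d0 dP] e e0.
have k0 : 0 < 1 + normc l by have := normc_ge0 l; lra.
exists (Num.min d (e / (1 + normc l))); first by rewrite lt_min d0 divr_gt0.
move=> z; rewrite /disc /= lt_min => /andP[zd ze].
have ad : disc a d a by rewrite /disc /= subrr normc0.
have := dP z a zd ad; rewrite mul1r => h.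
have -> : f z - f a = (f z - f a - l * (z - a)) + l * (z - a) by ring.
apply: le_trans (ler_normcD _ _) _; rewrite normcM.
move: ze; rewrite ltr_pdivlMr // => ze.
have : normc (z - a) + normc l * normc (z - a) <= e by lra.
by apply: le_trans; rewrite lerD2r.
Qed.

Lemma sdiff_cst c a : sdiff (fun=> c) a 0.
Proof.
rewrite /sdiff; apply: clim_near (clim_cst (offdiag a) 0).
by apply: filterE => p /=; rewrite subrr mul0r.
Qed.

Lemma sdiff_id a : sdiff id a 1.
Proof.
rewrite /sdiff; apply: clim_near (clim_cst (offdiag a) 1).
apply: filterS (offdiag_neq a) => p /= pn.
by rewrite divff // subr_eq0.
Qed.

Lemma sdiffD f g a l m : sdiff f a l -> sdiff g a m ->
  sdiff (fun z => f z + g z) a (l + m).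
Proof.
move=> fl gm; rewrite /sdiff; apply: clim_near (climD fl gm); apply: filterE => p /=.
by rewrite -mulrDl; congr (_ / _); ring.
Qed.

Lemma sdiffM f g a l m : sdiff f a l -> sdiff g a m ->
  sdiff (fun z => f z * g z) a (l * g a + f a * m).
Proof.
move=> fl gm.
have g1 : clim (offdiag a) (fun p => g p.1) (g a).
  by move=> e /(sdiff_cont gm) /offdiag_fst.
have f2 : clim (offdiag a) (fun p => f p.2) (f a).
  by move=> e /(sdiff_cont fl) /offdiag_snd.
rewrite /sdiff; apply: clim_near (climD (climM fl g1) (climM f2 gm)).
apply: filterS (offdiag_neq a) => p /=; rewrite -subr_eq0 => pn.
by field.
Qed.

Lemma sdiffV f a l : sdiff f a l -> f a != 0 ->
  sdiff (fun z => (f z)^-1) a (- l * (f a * f a)^-1).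
Proof.
move=> fl fa0; have fc := sdiff_cont fl.
have f1 : clim (offdiag a) (fun p => f p.1) (f a) by move=> e /fc /offdiag_fst.
have f2 : clim (offdiag a) (fun p => f p.2) (f a) by move=> e /fc /offdiag_snd.
have fa2 : f a * f a != 0 by rewrite mulf_neq0.
have n0 := ccont_neq0 fc fa0.
rewrite /sdiff -mulN1r.
apply: clim_near (climM (climM (clim_cst (offdiag a) (-1)) fl) (climV fa2 (climM f1 f2))).
apply: filterS3 (offdiag_neq a) (offdiag_fst n0) (offdiag_snd n0) => p /=.
by rewrite -subr_eq0 => pn n1 n2; field; rewrite pn n1 n2.
Qed.

Definition hol (A : set C) f := forall z, A z -> exists l, sdiff f z l.

Lemma hol_cont (A : set C) f z : hol A f -> A z -> ccont f z.
Proof. by move=> fh /fh [l /sdiff_cont]. Qed.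

Lemma hol_sub (A B : set C) f : B `<=` A -> hol A f -> hol B f.
Proof. by move=> BA fh z /BA /fh. Qed.

Lemma hol_cst (A : set C) c : hol A (fun=> c).
Proof. by move=> z _; exists 0; exact: sdiff_cst. Qed.

Lemma hol_id (A : set C) : hol A id.
Proof. by move=> z _; exists 1; exact: sdiff_id. Qed.

Lemma holD (A : set C) f g : hol A f -> hol A g -> hol A (fun z => f z + g z).
Proof. by move=> fh gh z /[dup] /fh[l fl] /gh[m gm]; exists (l + m); exact: sdiffD. Qed.

Lemma holM (A : set C) f g : hol A f -> hol A g -> hol A (fun z => f z * g z).
Proof. by move=> fh gh z /[dup] /fh[l fl] /gh[m gm]; eexists; exact: sdiffM fl gm. Qed.

Lemma holX (A : set C) f n : hol A f -> hol A (fun z => f z ^+ n).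
Proof.
move=> fh; elim: n => [|n ih]; first exact: (@hol_cst _ 1).
move=> z Az; have [l fl] := holM fh ih Az; exists l; apply: sdiff_near fl.
by apply: filterE => w /=; rewrite exprS.
Qed.

Lemma hol_sum (A : set C) (I : Type) (s : seq I) (f : I -> C -> C) :
  (forall i, hol A (f i)) -> hol A (fun z => \sum_(i <- s) f i z).
Proof.
move=> fh; elim: s => [|i s ih] z Az.
  by exists 0; apply: sdiff_near (sdiff_cst 0 z); apply: filterE => w /=; rewrite big_nil.
have [l fl] := holD (fh i) ih Az; exists l; apply: sdiff_near fl.
by apply: filterE => w /=; rewrite big_cons.
Qed.

End StrictDerivative.

(** * Uniform estimates on a compact square *)

Section Compactness.
Variable R : realType.
Local Notation C := R[i].

(** Compactness, for properties that depend on a point and on a scale.  A square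
   is a product of segments, so that its compactness comes from that of segments. *)
Lemma square_near (P : R -> C -> Prop) (r : R) :
  (forall x : C, `|complex.Re x| <= r -> `|complex.Im x| <= r ->
     exists2 d : R, 0 < d & forall y e, disc x d y -> 0 < e < d -> P e y) ->
  exists2 d : R, 0 < d &
    forall y : C, `|complex.Re y| <= r -> `|complex.Im y| <= r -> P d y.
Proof.
move=> Ploc.
have cpt := compact_setX (@segment_compact R (- r) r) (@segment_compact R (- r) r).
move/compact_near_coveringP : cpt => cov.
have key : \forall e \near 0^'+, `[- r, r] `*` `[- r, r] `<=`
    (fun p : R * R => P e (p.1 +i* p.2)).
  apply: (cov R (0^'+) (fun e p => P e (p.1 +i* p.2))) => -[x1 x2] [/= x1r x2r].
  have h1 : `|x1| <= r by move: x1r; rewrite in_itv /= ler_norml.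
  have h2 : `|x2| <= r by move: x2r; rewrite in_itv /= ler_norml.
  have [d d0 dP] := Ploc (x1 +i* x2) h1 h2.
  exists (ball (x1, x2) (d / 2), [set e | 0 < e < d]) => /=.
    split; first by apply: nbhsx_ballx; lra.
    near=> e; apply/andP; split; near: e; first exact: nbhs_right_gt.
    exact: nbhs_right_lt.
  move=> [[y1 y2] e] [/= [/= y1d y2d] ed]; apply: dP => //.
  apply: le_lt_trans (normc_le_ReIm (y1 +i* y2 - (x1 +i* x2))) _ => /=.
  move: y1d y2d; rewrite /ball /= distrC [`|x2 - y2|]distrC; lra.
have [e [e0 eP]] := filter_ex (filterI (nbhs_right_gt 0) key).
exists e => // -[y1 y2] /= h1 h2.
by apply: (eP (y1, y2)); split; rewrite /= in_itv /= -ler_norml.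
Unshelve. all: by end_near.
Qed.

Variables (f : C -> C) (rho r : R).
Hypotheses (f_hol : hol (disc 0 rho) f) (r_rho : 2 * r < rho).

Lemma square_disc (x : C) :
  `|complex.Re x| <= r -> `|complex.Im x| <= r -> disc 0 rho x.
Proof.
move=> h1 h2; rewrite /disc /= subr0.
by apply: le_lt_trans (normc_le_ReIm _) _; have := r_rho; lra.
Qed.

(** The derivative [l] moves with [x], but the scale [d] does not. *)
Lemma uniform_sdiff e : 0 < e -> exists2 d : R, 0 < d &
  forall x : C, normc x <= r -> exists l, forall w, disc x d w ->
    normc (f w - f x - l * (w - x)) <= e * normc (w - x).
Proof.
move=> e0.
pose P (d : R) (x : C) := exists l, forall w, disc x d w ->
  normc (f w - f x - l * (w - x)) <= e * normc (w - x).
have [x x1 x2|d d0 dP] := @square_near P r; last first.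
  exists d => // x xr; apply: dP; first exact: le_trans (normc_Re x) _.
  exact: le_trans (normc_Im x) _.
have [l /sdiffP /(_ e e0) [d d0 dP]] := f_hol (square_disc x1 x2).
exists (d / 2) => [|y d' yd /andP[d'0 d'd]]; first by lra.
exists l => w wd; apply: dP; move: wd yd; rewrite /disc /=; last by lra.
by move=> wd yd; apply: le_lt_trans (ler_distc y _ _) _; lra.
Qed.

Lemma bounded_disc :
  exists2 M : R, 0 < M & forall x : C, normc x <= r -> normc (f x) <= M.
Proof.
pose P (d : R) (x : C) := normc (f x) <= d^-1.
have [x x1 x2|d d0 dP] := @square_near P r; last first.
  exists d^-1 => [|x xr]; first by rewrite invr_gt0.
  apply: dP; first exact: le_trans (normc_Re x) _.
  exact: le_trans (normc_Im x) _.
have [d d0 dP] := hol_cont f_hol (square_disc x1 x2) ltr01.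
have M0 : 0 < normc (f x) + 1 by have := normc_ge0 (f x); lra.
exists (Num.min d (normc (f x) + 1)^-1); first by rewrite lt_min d0 invr_gt0.
move=> y e; rewrite /disc /= !lt_min => /andP[yd _] /and3P[e0 ed eM].
have := dP _ yd => /= h; rewrite /P -[f y](subrK (f x)).
apply: le_trans (ler_normcD _ _) _.
apply: le_trans (_ : normc (f x) + 1 <= _); first by lra.
by rewrite -[leLHS]invrK lef_pV2 ?posrE ?invr_gt0 // ltW.
Qed.

End Compactness.

(** * Roots of unity *)

Section RootsOfUnity.
Variable R : realType.
Local Notation C := R[i].

Definition omega (n : nat) : C :=
  cos (pi *+ 2 / n%:R) +i* sin (pi *+ 2 / n%:R).

Lemma normc_omega n : normc (omega n) = 1.
Proof. by rewrite /= cos2Dsin2 sqrtr1. Qed.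

Lemma omega_neq0 n : omega n != 0.
Proof. by rewrite -normc_gt0 normc_omega. Qed.

Lemma omegaV n : (omega n)^-1 = (omega n)^*.
Proof.
apply: (mulfI (omega_neq0 n)); rewrite divff ?omega_neq0 //.
apply/eqP; rewrite eq_sym eq_complex /=; apply/andP; split; apply/eqP; last by ring.
by rewrite -[RHS](cos2Dsin2 (pi *+ 2 / n%:R)); ring.
Qed.

Lemma omegaX n k : omega n ^+ k =
  cos (pi *+ 2 / n%:R * k%:R) +i* sin (pi *+ 2 / n%:R * k%:R).
Proof.
elim: k => [|k ih]; first by rewrite mulr0 cos0 sin0.
rewrite exprSr ih -natr1 mulrDr mulr1 cosD sinD.
by congr Complex; rewrite addrC.
Qed.

Lemma omegaXn n : omega n ^+ n = 1.
Proof.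
case: n => [|n]; first by rewrite expr0.
by rewrite omegaX divfK ?pnatr_eq0 // cos2pi sin2pi.
Qed.

(** Half of the angle of a nontrivial power lies strictly between [0] and [pi],
   where the sine is positive. *)
Lemma omegaX_neq1 n k : (0 < k < n)%N -> omega n ^+ k != 1.
Proof.
move=> /andP[k0 kn]; have n1 : (0 < n)%N by apply: leq_trans kn.
have n0 : (0 : R) < n%:R by rewrite ltr0n.
set t := pi / n%:R * k%:R : R.
have t0 : 0 < t by rewrite /t !mulr_gt0 ?pi_gt0 ?invr_gt0 ?ltr0n.
have tpi : t < pi.
  by rewrite /t mulrAC ltr_pdivrMr // ltr_pM2l ?pi_gt0 // ltr_nat.
rewrite omegaX; apply/negP => /eqP.
move=> /(congr1 (@complex.Re R)) /=.
have -> : pi *+ 2 / n%:R * k%:R = t *+ 2 by rewrite /t -!mulrnAl.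
rewrite cos_mulr2n => h; have : sin t ^+ 2 = 0.
  by have := cos2Dsin2 t; move: h; rewrite mulr2n; lra.
by move/eqP; rewrite sqrf_eq0 gt_eqF // sin_gt0_pi // t0.
Qed.

Lemma sum_omegaX n k : (0 < k < n)%N -> \sum_(0 <= j < n) (omega n ^+ k) ^+ j = 0.
Proof.
move=> kn; have := omegaX_neq1 kn; rewrite -subr_eq0 => w1.
apply: (mulfI w1); rewrite big_mkord -subrX1 exprAC omegaXn expr1n subrr.
by rewrite mulr0.
Qed.

Lemma omega_cvg1 : clim \oo omega 1.
Proof.
move=> e e0; have e20 : 0 < e / 2 by lra.
apply: near_inftyS; have a0 : pi *+ 2 / n.+1%:R @[n --> \oo] --> (0 : R).
  by rewrite -(mulr0 (pi *+ 2)); apply: cvgMl_tmp; exact: cvg_harmonic.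
have ccos : cos (pi *+ 2 / n.+1%:R) @[n --> \oo] --> cos (0 : R).
  by apply: continuous_cvg a0; exact: continuous_cos.
have csin : sin (pi *+ 2 / n.+1%:R) @[n --> \oo] --> sin (0 : R).
  by apply: continuous_cvg a0; exact: continuous_sin.
move/cvgrPdist_le : ccos => /(_ _ e20) n1.
move/cvgrPdist_le : csin => /(_ _ e20) n2.
apply: filterS2 n1 n2 => n; rewrite cos0 sin0 sub0r normrN [`|1 - _|]distrC => h1 h2.
by apply: le_trans (normc_le_ReIm _) _; rewrite /= oppr0 addr0; lra.
Qed.

End RootsOfUnity.

(** * Cauchy's formula as a limit of Riemann sums *)

Section DiscreteCauchy.
Variable R : realType.
Local Notation C := R[i].

(** A Riemann sum for the mean of [g] over the circle of radius [r].  Only sums of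
   this kind occur below, in place of contour integrals. *)
Definition cmean (g : C -> C) (r : R) (n : nat) : C :=
  n%:R^-1 * \sum_(0 <= k < n) g (r%:C * omega R n ^+ k).

Lemma normc_circle (r : R) n k : 0 < r -> normc (r%:C * omega R n ^+ k) = r.
Proof.
by move=> r0; rewrite normcM normc_real normcX normc_omega expr1n mulr1 gtr0_norm.
Qed.

Lemma eq_cmean (g h : C -> C) (r : R) n : 0 < r ->
  (forall z, normc z = r -> g z = h z) -> cmean g r n = cmean h r n.
Proof.
move=> r0 gh; congr (_ * _); apply: eq_big_nat => k _.
by rewrite gh // normc_circle.
Qed.

Lemma cmeanD (g h : C -> C) r n :
  cmean (fun z => g z + h z) r n = cmean g r n + cmean h r n.
Proof. by rewrite /cmean big_split mulrDr. Qed.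

Lemma cmeanZ (c : C) (g : C -> C) r n :
  cmean (fun z => c * g z) r n = c * cmean g r n.
Proof. by rewrite /cmean -mulr_sumr mulrCA. Qed.

Lemma normc_natr n : normc (n%:R : C) = n%:R.
Proof. by rewrite -(rmorph_nat (real_complex R)) normc_real normr_nat. Qed.

Lemma normc_cmean (g : C -> C) (r M : R) n : 0 < r -> 0 <= M ->
  (forall z, normc z = r -> normc (g z) <= M) -> normc (cmean g r n) <= M.
Proof.
move=> r0 M0 gM; rewrite /cmean normcM.
have [->|n0] := eqVneq n 0%N; first by rewrite invr0 normc0 mul0r.
have n1 : (0 : R) < n%:R by rewrite ltr0n lt0n.
rewrite normcV normc_natr mulrC ler_pdivrMr //.
apply: le_trans (ler_normc_sum _ _ _) _.
apply: le_trans (_ : \sum_(0 <= k < n) M <= _).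
  by apply: ler_sum => k _; apply: gM; rewrite normc_circle.
by rewrite big_const_nat iter_addr_0 subn0 mulr_natr.
Qed.

Lemma clim_expr0 (x : C) : normc x < 1 -> clim \oo (fun n => x ^+ n) 0.
Proof.
move=> x1 e e0; have : `|normc x| < 1 by rewrite ger0_norm ?normc_ge0.
move=> /cvg_expr /cvgr0_norm_le /(_ e e0); apply: filterS => n /=.
by rewrite subr0 normcX ger0_norm // exprn_ge0 // normc_ge0.
Qed.

Lemma geometric_root (x u : C) n : (1 - x * u) != 0 -> u ^+ n = 1 ->
  (1 - x ^+ n) / (1 - x * u) = \sum_(0 <= j < n) x ^+ j * u ^+ j.
Proof.
move=> xu un; apply: (mulIf xu); rewrite divfK //.
rewrite big_mkord; under eq_bigr do rewrite -exprMn.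
have -> : x ^+ n = (x * u) ^+ n by rewrite exprMn un mulr1.
by rewrite -opprB subrX1 -mulNr opprB mulrC.
Qed.

(** Each term is a geometric sum; the sums over the roots of unity cancel all
   powers but the zeroth. *)
Lemma cmean_kernel (r : R) (z : C) n : 0 < r -> normc z < r -> (0 < n)%N ->
  cmean (fun w => w / (w - z)) r n = (1 - (z / r%:C) ^+ n)^-1.
Proof.
move=> r0 zr n0; set x := z / r%:C; set u := (omega R n)^-1.
have rC : r%:C != 0 by rewrite -normc_gt0 normc_real gtr0_norm.
have x1 : normc x < 1.
  by rewrite normcM normcV normc_real gtr0_norm // ltr_pdivrMr // mul1r.
have nu k : normc (u ^+ k) = 1 by rewrite normcX normcV normc_omega invr1 expr1n.
have neq1 (y : C) : normc y < 1 -> 1 - y != 0.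
  by apply: contraTneq => /subr0_eq <-; rewrite normc1 ltxx.
have xn : 1 - x ^+ n != 0.
  apply: neq1; rewrite normcX; apply: le_lt_trans (x1).
  by rewrite ler_iXnr ?normc_ge0 // ltW.
have nC : (n%:R : C) != 0 by rewrite pnatr_eq0 -lt0n.
apply: (mulfI xn); rewrite divff // /cmean mulrCA mulr_sumr.
rewrite (_ : \sum_(_ <= k < _) _ =
    \sum_(0 <= k < n) \sum_(0 <= j < n) x ^+ j * (u ^+ j) ^+ k); last first.
  apply: eq_big_nat => k _.
  have xuk : 1 - x * u ^+ k != 0 by apply: neq1; rewrite normcM nu mulr1.
  have uk1 : (u ^+ k) ^+ n = 1 by rewrite exprAC /u exprVn omegaXn invr1 expr1n.
  have -> : \sum_(0 <= j < n) x ^+ j * (u ^+ j) ^+ k =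
      (1 - x ^+ n) / (1 - x * u ^+ k).
    by rewrite (geometric_root xuk uk1); apply: eq_bigr => j _; rewrite exprAC.
  have wk : omega R n ^+ k != 0 by rewrite expf_neq0 ?omega_neq0.
  move: xuk; rewrite /x /u exprVn => xuk.
  have d0 : r%:C * omega R n ^+ k - z != 0.
    apply: contra xuk => /eqP /subr0_eq <-.
    by apply/eqP; field; rewrite rC wk.
  by congr (_ * _); field; rewrite d0 rC wk.
rewrite exchange_big_nat /= big_ltn // expr0.
rewrite (eq_bigr (fun=> 1)) => [|k _]; last by rewrite expr0 expr1n mulr1.
rewrite big_const_nat iter_addr_0 subn0 big_nat_cond big1 => [|j].
  by rewrite addr0 mulVf.
rewrite andbT => /andP[j0 jn]; rewrite -mulr_sumr.
have -> : \sum_(0 <= k < n) (u ^+ j) ^+ k = 0.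
  have -> : \sum_(0 <= k < n) (u ^+ j) ^+ k =
      (\sum_(0 <= k < n) (omega R n ^+ j) ^+ k)^*.
    rewrite rmorph_sum; apply: eq_bigr => k _; rewrite !rmorphXn.
    by rewrite /u omegaV.
  by rewrite sum_omegaX ?j0 // rmorph0.
by rewrite mulr0.
Qed.

Section Homotopy.
Variables (f : C -> C) (rho r : R) (z : C).
Hypotheses (f_hol : hol (disc 0 rho) f) (r0 : 0 < r) (r_rho : 2 * r < rho).
Hypothesis zr : normc z < r.

Let zeta n k : C := r%:C * omega R n ^+ k.
Let pt n k (t : R) : C := z + t%:C * (zeta n k - z).
Let phi n t : C := \sum_(0 <= k < n) f (pt n k t) * (zeta n k / (zeta n k - z)).

Let zeta_neq n k : zeta n k - z != 0.
Proof.
apply: contraTneq zr => /subr0_eq <-.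
by rewrite normc_circle // ltxx.
Qed.

Let normc_pt n k t : 0 <= t <= 1 -> normc (pt n k t) <= r.
Proof.
move=> /andP[t0 t1].
have -> : pt n k t = (1 - t)%:C * z + t%:C * zeta n k.
  by rewrite /pt rmorphB rmorph1; ring.
apply: le_trans (ler_normcD _ _) _.
rewrite (normcM (1 - t)%:C) (normcM t%:C) normc_circle // !normc_real.
rewrite ger0_norm ?subr_ge0 // (ger0_norm t0).
have : (1 - t) * normc z <= (1 - t) * r by rewrite ler_wpM2l ?subr_ge0 // ltW.
lra.
Qed.

(** Contracting the circle to [z] moves the sum [phi] at a speed close to
   [\sum l_k zeta_k], where [l_k] is the derivative of [f] at the [k]-th point.
   That sum is small because it is, up to the factor [t (omega - 1)] and an error
   controlled by uniform strict differentiability, the telescoping sum of the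
   increments of [f] around the contracted circle. *)
Lemma homotopy_step (e d : R) (l : C -> C) n (s t : R) : 0 <= e ->
  (forall x w, normc x <= r -> disc x d w ->
     normc (f w - f x - l x * (w - x)) <= e * normc (w - x)) ->
  omega R n != 1 -> r * normc (omega R n - 1) < d ->
  0 <= s < t -> t <= 1 -> (t - s) * (2 * r) < d ->
  normc (phi n s - phi n t) <= 2 * e * r * n%:R * (t - s).
Proof.
move=> e0 lP w1 wd /andP[s0 st] t1 tsd; have t0 : 0 < t by apply: le_lt_trans st.
have t01 : 0 <= t <= 1 by rewrite ltW.
set w := omega R n in w1 wd *.
have nw0 : 0 < normc (w - 1) by rewrite normc_gt0 subr_eq0.
have zS k : zeta n k.+1 - zeta n k = zeta n k * (w - 1).
  by rewrite /zeta /w exprSr; ring.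
have nz k : normc (zeta n k) = r by rewrite normc_circle.
pose L := \sum_(0 <= k < n) l (pt n k t) * zeta n k.
have ptS k : pt n k.+1 t - pt n k t = t%:C * (zeta n k * (w - 1)).
  by rewrite -zS /pt; ring.
have nptS k : normc (pt n k.+1 t - pt n k t) = t * (r * normc (w - 1)).
  by rewrite ptS (normcM t%:C) (normcM (zeta n k)) nz normc_real gtr0_norm.
have L_small : normc L <= e * r * n%:R.
  have tele : \sum_(0 <= k < n) (f (pt n k.+1 t) - f (pt n k t)) = 0.
    rewrite telescope_sumr // (_ : pt n n t = pt n 0 t) ?subrr //.
    by rewrite /pt /zeta omegaXn expr0.
  have LE : t%:C * (w - 1) * L = - \sum_(0 <= k < n)
     (f (pt n k.+1 t) - f (pt n k t) - l (pt n k t) * (pt n k.+1 t - pt n k t)).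
    rewrite sumrB tele sub0r opprK /L mulr_sumr; apply: eq_bigr => k _.
    by rewrite ptS; ring.
  have tw0 : 0 < t * normc (w - 1) by rewrite mulr_gt0.
  rewrite -(ler_pM2l tw0).
  have -> : t * normc (w - 1) * normc L = normc (t%:C * (w - 1) * L).
    by rewrite !normcM normc_real gtr0_norm.
  rewrite LE normc_opp; apply: le_trans (ler_normc_sum _ _ _) _.
  apply: le_trans (_ : \sum_(0 <= k < n) e * (t * (r * normc (w - 1))) <= _).
    apply: ler_sum => k _; rewrite -(nptS k); apply: lP; first exact: normc_pt.
    rewrite /disc /= nptS; apply: le_lt_trans wd.
    by rewrite -[leRHS]mul1r ler_wpM2r // mulr_ge0 ?normc_ge0 // ltW.
  rewrite big_const_nat iter_addr_0 subn0 -mulr_natr.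
  by rewrite le_eqVlt; apply/orP; left; apply/eqP; ring.
have dpt k : pt n k s - pt n k t = (s - t)%:C * (zeta n k - z).
  by rewrite /pt rmorphB; ring.
have -> : phi n s - phi n t = (s - t)%:C * L + \sum_(0 <= k < n)
    (f (pt n k s) - f (pt n k t) - l (pt n k t) * (pt n k s - pt n k t)) *
      (zeta n k / (zeta n k - z)).
  rewrite /phi -sumrB /L mulr_sumr -big_split; apply: eq_bigr => k _ /=.
  by rewrite dpt; field; exact: zeta_neq.
apply: le_trans (ler_normcD _ _) _.
have nst : normc (s - t)%:C = t - s by rewrite normc_real distrC gtr0_norm ?subr_gt0.
have h1 : normc ((s - t)%:C * L) <= e * r * n%:R * (t - s).
  by rewrite normcM nst mulrC ler_wpM2r // subr_ge0 ltW.
suff h2 : normc (\sum_(0 <= k < n)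
    (f (pt n k s) - f (pt n k t) - l (pt n k t) * (pt n k s - pt n k t)) *
      (zeta n k / (zeta n k - z))) <= e * r * n%:R * (t - s) by lra.
apply: le_trans (ler_normc_sum _ _ _) _.
apply: le_trans (_ : \sum_(0 <= k < n) e * (t - s) * r <= _); last first.
  rewrite big_const_nat iter_addr_0 subn0 -mulr_natr.
  by rewrite le_eqVlt; apply/orP; left; apply/eqP; ring.
apply: ler_sum => k _; have nk : 0 < normc (zeta n k - z) by rewrite normc_gt0.
rewrite normcM normcM normcV nz.
have -> : e * (t - s) * r =
    e * ((t - s) * normc (zeta n k - z)) * (r / normc (zeta n k - z)).
  by field; rewrite gt_eqF.
apply: ler_wpM2r; first by rewrite divr_ge0 // ltW.
have nd : normc (pt n k s - pt n k t) = (t - s) * normc (zeta n k - z).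
  by rewrite dpt normcM nst.
rewrite -nd; apply: lP; first exact: normc_pt.
rewrite /disc /= nd; apply: le_lt_trans tsd.
apply: ler_wpM2l; first by rewrite subr_ge0 ltW.
by apply: le_trans (ler_normcB _ _) _; rewrite nz; have := zr; lra.
Qed.

(** The segment [0, 1] is cut into steps on which the previous estimate applies; at
   each of them the base point is the right end, where the circle is not yet
   contracted to a point. *)
Lemma homotopy_bound e : 0 < e ->
  \forall n \near \oo, normc (phi n 0 - phi n 1) <= e * n%:R.
Proof.
move=> e0; pose e1 := e / (2 * r); have e10 : 0 < e1 by rewrite divr_gt0 ?mulr_gt0.
have [d d0 dP] := uniform_sdiff f_hol r_rho e10.
have /choice[l lP] : forall x, exists l, normc x <= r -> forall w, disc x d w ->
    normc (f w - f x - l * (w - x)) <= e1 * normc (w - x).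
  move=> x; have [xr|xr] := leP (normc x) r; last by exists 0.
  by have [l lP] := dP x xr; exists l.
have dr0 : 0 < d / (2 * r) by rewrite divr_gt0 // mulr_gt0.
have [m mP] : exists m, m.+1%:R^-1 < d / (2 * r).
  by have [m mP] := filter_ex (near_infty_natSinv_lt (PosNum dr0)); exists m.
have r20 : 0 < 2 * r by rewrite mulr_gt0.
have wn := omega_cvg1 dr0.
apply: filterS2 wn (nbhs_infty_gt 1) => n /= nw n1.
have w1 : omega R n != 1 by have := @omegaX_neq1 R n 1; rewrite expr1 => ->.
have wd : r * normc (omega R n - 1) < d.
  apply: le_lt_trans (_ : r * (d / (2 * r)) < d); first by rewrite ler_pM2l.
  have -> : r * (d / (2 * r)) = d / 2 by field; rewrite gt_eqF.
  lra.
have M0 : (0 : R) < m.+1%:R by rewrite ltr0n.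
have key j : (j <= m.+1)%N ->
    normc (phi n 0 - phi n (j%:R / m.+1%:R)) <= e * n%:R * (j%:R / m.+1%:R).
  elim: j => [_|j ih jm]; first by rewrite mul0r subrr normc0 mulr0.
  apply: le_trans (ler_distc (phi n (j%:R / m.+1%:R)) _ _) _.
  have st : j.+1%:R / m.+1%:R - j%:R / m.+1%:R = m.+1%:R^-1 :> R.
    by rewrite -mulrBl -natr1 addrAC subrr add0r mul1r.
  apply: le_trans (lerD (ih (ltnW jm)) (@homotopy_step e1 d l n _ _ _ _ _ _ _ _ _)) _.
  - exact: ltW.
  - by move=> x w xr; exact: lP.
  - by [].
  - by [].
  - by rewrite divr_ge0 //= -subr_gt0 st invr_gt0.
  - by rewrite ler_pdivrMr // mul1r ler_nat.
  - by rewrite st -ltr_pdivlMr.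
  have jS : j.+1%:R = j%:R + 1 :> R by rewrite natr1.
  rewrite st /e1 jS le_eqVlt; apply/orP; left; apply/eqP.
  move: M0; set M : R := m.+1%:R => M0.
  by field; rewrite !gt_eqF.
by have := key m.+1 (leqnn _); rewrite divff ?gt_eqF // mulr1.
Qed.

(** At [t = 1] the sum [phi] is [n] times the mean of the Cauchy integrand, and at
   [t = 0] it is [n * f z] times the mean of the Cauchy kernel, which tends to [1]. *)
Lemma discrete_cauchy : clim \oo (cmean (fun w => f w * (w / (w - z))) r) (f z).
Proof.
have k0 : clim \oo (cmean (fun w => w / (w - z)) r) 1.
  have x1 : normc (z / r%:C) < 1.
    by rewrite normcM normcV normc_real gtr0_norm // ltr_pdivrMr // mul1r.
  have lim1 : clim \oo (fun n => (1 + -1 * (z / r%:C) ^+ n)^-1) (1 + -1 * 0)^-1.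
    apply: climV; first by rewrite mulr0 addr0 oner_neq0.
    by apply: climD (clim_cst _ _) (climM (clim_cst _ _) (clim_expr0 x1)).
  rewrite mulr0 addr0 invr1 in lim1; apply: clim_near lim1.
  by apply: filterS (nbhs_infty_gt 0) => n /= n0; rewrite cmean_kernel // mulN1r.
have h0 : clim \oo (fun n => cmean (fun w => f w * (w / (w - z))) r n -
    f z * cmean (fun w => w / (w - z)) r n) 0.
  move=> e e0; apply: filterS2 (homotopy_bound e0) (nbhs_infty_gt 0) => n /= hn n0.
  rewrite subr0 distcC -cmeanZ.
  have n1 : (0 : R) < n%:R by rewrite ltr0n.
  have -> : cmean (fun w => f z * (w / (w - z))) r n -
      cmean (fun w => f w * (w / (w - z))) r n = n%:R^-1 * (phi n 0 - phi n 1).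
    have pt1 k : pt n k 1 = zeta n k by rewrite /pt rmorph1; ring.
    have pt0 k : pt n k 0 = z by rewrite /pt rmorph0; ring.
    rewrite /cmean -mulrBr; congr (_ * (_ - _)); apply: eq_bigr => k _.
      by rewrite pt0.
    by rewrite pt1.
  by rewrite normcM normcV normc_natr mulrC ler_pdivrMr.
rewrite -[f z]mulr1 -[f z * 1]add0r.
apply: clim_near (climD h0 (climM (clim_cst _ (f z)) k0)).
by apply: filterE => n /=; rewrite subrK.
Qed.

End Homotopy.

End DiscreteCauchy.

(** * Extension of limits *)

Section Completeness.
Variable R : realType.
Local Notation C := R[i].

Lemma clim_le (T : Type) (F : set_system T) {FF : ProperFilter F}
    (f : T -> C) (l : C) (M : R) :
  clim F f l -> F [set x | normc (f x) <= M] -> normc l <= M.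
Proof.
move=> fl fM; apply/ler_addgt0Pl => e e0.
have [x [/= h1 h2]] := filter_ex (filterI (fl _ e0) fM).
have -> : l = f x - (f x - l) by ring.
by apply: le_trans (ler_normcB _ _) _; lra.
Qed.

Lemma clim_complete (a : nat -> C) :
  (forall e, 0 < e -> exists l, \forall n \near \oo, normc (a n - l) <= e) ->
  exists l, clim \oo a l.
Proof.
move=> approx.
have re_cvg : cvg ((@complex.Re R \o a) @ \oo).
  apply/cauchy_cvgP/cauchy_exP => e e0.
  have e20 : 0 < e / 2 by lra.
  have [l al] := approx _ e20; exists (complex.Re l).
  apply: filterS al => n al; rewrite /ball /= -raddfB.
  by apply: le_lt_trans (normc_Re _) _; rewrite distcC; lra.
have im_cvg : cvg ((@complex.Im R \o a) @ \oo).
  apply/cauchy_cvgP/cauchy_exP => e e0.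
  have e20 : 0 < e / 2 by lra.
  have [l al] := approx _ e20; exists (complex.Im l).
  apply: filterS al => n al; rewrite /ball /= -raddfB.
  by apply: le_lt_trans (normc_Im _) _; rewrite distcC; lra.
exists (lim ((@complex.Re R \o a) @ \oo) +i* lim ((@complex.Im R \o a) @ \oo)).
move=> e e0; have e20 : 0 < e / 2 by lra.
move/cvgrPdist_le : re_cvg => /(_ _ e20) n1.
move/cvgrPdist_le : im_cvg => /(_ _ e20) n2.
apply: filterS2 n1 n2 => n /= h1 h2.
apply: le_trans (normc_le_ReIm _) _; rewrite !raddfB /=.
by rewrite [X in X + _]distrC [X in _ + X]distrC; lra.
Qed.

(** Continuity at [a] lets one of the two points of the difference quotient move
   to [a]. *)
Lemma sdiff_punctured (f : C -> C) a l : ccont f a ->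
  (forall e, 0 < e -> exists2 d : R, 0 < d & forall z w, disc a d z -> disc a d w ->
     z != a -> w != a -> z != w -> normc ((f z - f w) / (z - w) - l) <= e) ->
  sdiff f a l.
Proof.
move=> fc fl e e0; have [d d0 dP] := fl e e0.
have half z : disc a d z -> z != a -> normc ((f z - f a) / (z - a) - l) <= e.
  move=> zd za; have za0 : z - a != 0 by rewrite subr_eq0.
  apply: (@clim_le _ (cdnbhs a) _ (fun w => (f z - f w) / (z - w) - l)).
    have lim1 : clim (cnbhs a) (fun w => (f z + -1 * f w) * (z + -1 * w)^-1 + - l)
        ((f z + -1 * f a) * (z + -1 * a)^-1 + - l).
      apply: climD (clim_cst _ _); apply: climM.
        exact: climD (clim_cst _ _) (climM (clim_cst _ _) fc).
      apply: climV; first by rewrite mulN1r.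
      exact: climD (clim_cst _ _) (climM (clim_cst _ _) (ccont_id a)).
    rewrite !mulN1r in lim1; apply: clim_dnbhs; apply: clim_near lim1.
    by apply: filterE => w /=; rewrite !mulN1r.
  have zn : cnbhs a [set w | z != w].
    exists (normc (z - a)); first by rewrite normc_gt0.
    by move=> w; rewrite /disc /=; apply: contraTneq => <-; rewrite ltxx.
  apply: filterS2 (zn) (cnbhs_disc a d0) => w /= zw wd wa.
  by apply: dP => //; exact: zw.
exists d => // z w zd wd zw /=.
have [za|za] := eqVneq z a; last first.
  have [->|wa] := eqVneq w a; first exact: half.
  exact: dP.
rewrite za in zw zd *; have wa : w != a by rewrite eq_sym.
have -> : (f a - f w) / (a - w) = (f w - f a) / (w - a).
  by rewrite -[a - w]opprB -[f a - f w]opprB invrN mulrNN.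
exact: half.
Qed.

End Completeness.

(** * Orders of zeroes and the identity theorem on a disc *)

Section Division.
Variable R : realType.
Local Notation C := R[i].

Section AtZero.
Variables (f : C -> C) (rho r : R) (l : C).
Hypotheses (f_hol : hol (disc 0 rho) f) (r0 : 0 < r) (r_rho : 2 * r < rho).
Hypotheses (f0 : f 0 = 0) (fl : sdiff f 0 l).

Let u z := if z == 0 then l else f z / z.
Let q n z := cmean (fun w => f w / (w - z)) r n.
Let a n := cmean (fun w => f w / (w * w)) r n.

Let q_cvg z : z != 0 -> normc z < r -> clim \oo (q^~ z) (u z).
Proof.
move=> z0 zr; have n0 : normc (0 : C) < r by rewrite normc0.
have uE : u z = z^-1 * (f z + -1 * f 0).
  by rewrite f0 mulr0 addr0 mulrC /u (negbTE z0).
rewrite uE; apply: clim_near (climM (clim_cst _ z^-1)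
  (climD (discrete_cauchy f_hol r0 r_rho zr)
    (climM (clim_cst _ (-1)) (discrete_cauchy f_hol r0 r_rho n0)))).
apply: filterE => n /=.
rewrite -!cmeanZ -cmeanD -cmeanZ; apply: eq_cmean => // w wr.
have w0 : w != 0 by rewrite -normc_gt0 wr.
have wz : w - z != 0 by apply: contraTneq zr => /subr0_eq <-; rewrite wr ltxx.
by rewrite subr0; field; rewrite z0 w0 wz.
Qed.

Let u_cont : ccont u 0.
Proof.
move=> e e0; have [d d0 dP] := fl e0.
exists d => // z zd /=; rewrite /u eqxx; case: ifPn => [_|z0].
  by rewrite subrr normc0 ltW.
have d00 : disc 0 d (0 : C) by exact: disc_center.
by have := dP z 0 zd d00 z0; rewrite /= f0 !subr0.
Qed.

(** The second order remainder of the Cauchy kernel at [0]. *)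
Let kernel_bound : exists2 L : R, 0 < L & forall n z w,
  normc z <= r / 2 -> normc w <= r / 2 ->
  normc (q n z - q n w - (z - w) * a n) <= L * (normc z + normc w) * normc (z - w).
Proof.
have r_gt0 := r0; have [M M0 fM] := bounded_disc f_hol r_rho.
exists (8 * M / r ^+ 3); first by rewrite !mulr_gt0 ?invr_gt0 ?exprn_gt0.
move=> n z w zr wr.
have nz := normc_ge0 z; have nw := normc_ge0 w.
have -> : q n z - q n w - (z - w) * a n =
    cmean (fun x => (z - w) * (f x * ((x * (z + w) - z * w) /
      (x * x * ((x - z) * (x - w)))))) r n.
  have -> : q n z - q n w - (z - w) * a n =
    q n z + -1 * q n w + -1 * ((z - w) * a n) by ring.
  rewrite /q /a -!cmeanZ -!cmeanD.
  apply: eq_cmean => // x xr.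
  have x0 : x != 0 by rewrite -normc_gt0 xr.
  have xz : x - z != 0.
    by apply: contraTneq zr => /subr0_eq <-; rewrite xr -ltNge; lra.
  have xw : x - w != 0.
    by apply: contraTneq wr => /subr0_eq <-; rewrite xr -ltNge; lra.
  by field; rewrite x0 xz xw.
apply: normc_cmean => //.
  by rewrite !mulr_ge0 ?invr_ge0 ?exprn_ge0 ?addr_ge0 ?normc_ge0 // ltW.
move=> x xr; rewrite normcM [leRHS]mulrC; apply: ler_wpM2l; first exact: normc_ge0.
rewrite normcM.
have -> : 8 * M / r ^+ 3 * (normc z + normc w) =
    M * ((r * (normc z + normc w) * 2) / (r * r * (r / 2 * (r / 2)))).
  by field; rewrite gt_eqF.
apply: ler_pM; rewrite ?normc_ge0 //; first by rewrite fM // xr.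
have xz : r / 2 <= normc (x - z).
  by have := ler_normcD (x - z) z; rewrite subrK xr; lra.
have xw : r / 2 <= normc (x - w).
  by have := ler_normcD (x - w) w; rewrite subrK xr; lra.
rewrite normcM normcV; apply: ler_pM; rewrite ?normc_ge0 ?invr_ge0 ?normc_ge0 //.
  apply: le_trans (ler_normcB _ _) _; rewrite !normcM xr.
  have h1 : r * normc (z + w) <= r * (normc z + normc w).
    by rewrite ler_pM2l // ler_normcD.
  have h2 : normc z * normc w <= r * normc w by rewrite ler_wpM2r //; lra.
  have : 0 <= r * normc z by rewrite mulr_ge0 // ltW.
  lra.
have r20 : 0 < r / 2 by lra.
rewrite lef_pV2 ?posrE ?normcM ?xr; last 2 first.
- by rewrite !mulr_gt0 //; lra.
- by rewrite !mulr_gt0.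
by rewrite ler_pM2l ?mulr_gt0 // ler_pM // ltW.
Qed.

(** By Cauchy's formula [f z / z] is, away from [0], the limit of the functions
   [q n], which are smooth across [0].  Their difference quotients are Lipschitz
   uniformly in [n], so that the limit inherits a strict derivative at [0]: the
   limit of the second coefficients [a n], which form a Cauchy sequence. *)
Lemma division0 : exists m, sdiff u 0 m.
Proof.
have r_gt0 := r0; have [L L0 LP] := kernel_bound.
have small (e : R) : 0 < e -> exists2 d : R, 0 < d <= r / 2 & forall z w : C,
    normc z < d -> normc w < d -> L * (normc z + normc w) <= e.
  move=> e0; exists (Num.min (r / 2) (e / (2 * L))).
    by rewrite lt_min ge_min lexx divr_gt0 // divr_gt0 // mulr_gt0.
  move=> z w; rewrite !lt_min !ltr_pdivlMr ?mulr_gt0 // => /andP[_ h1] /andP[_ h2].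
  lra.
have div n z w : z != w -> (q n z - q n w) / (z - w) - a n =
    (q n z - q n w - (z - w) * a n) / (z - w).
  by rewrite -subr_eq0 => zw; field.
have qdiff n z w : normc z <= r / 2 -> normc w <= r / 2 -> z != w ->
    normc ((q n z - q n w) / (z - w) - a n) <= L * (normc z + normc w).
  move=> zr wr zw; have zw0 : 0 < normc (z - w) by rewrite normc_gt0 subr_eq0.
  by rewrite div // normcM normcV ler_pdivrMr //; exact: LP.
have qd_cvg z w : z != 0 -> w != 0 -> normc z < r -> normc w < r ->
    clim \oo (fun n => (q n z - q n w) / (z - w)) ((u z - u w) / (z - w)).
  move=> z0 w0 zr wr; apply: climM (clim_cst _ _).
  rewrite -[u w]mul1r -mulNr.
  apply: clim_near (climD (q_cvg z0 zr) (climM (clim_cst _ (-1)) (q_cvg w0 wr))).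
  by apply: filterE => n /=; rewrite mulN1r.
have [m am] : exists m, clim \oo a m.
  apply: clim_complete => e e0; have e20 : 0 < e / 2 by lra.
  have [d /andP[d0 dr] dP] := small _ e20.
  pose z := (d / 2)%:C : C; pose w := (d / 4)%:C : C.
  have nz : normc z = d / 2 by rewrite normc_real ger0_norm //; lra.
  have nw : normc w = d / 4 by rewrite normc_real ger0_norm //; lra.
  have z0 : z != 0 by rewrite -normc_gt0 nz; lra.
  have w0 : w != 0 by rewrite -normc_gt0 nw; lra.
  have zw : z != w.
    by apply/eqP => /(congr1 (@normc R)); rewrite nz nw; lra.
  have zr : normc z < r by rewrite nz; lra.
  have wr : normc w < r by rewrite nw; lra.
  exists ((u z - u w) / (z - w)).
  apply: filterS (qd_cvg z w z0 w0 zr wr _ e20) => n /= h.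
  apply: le_trans (ler_distc ((q n z - q n w) / (z - w)) _ _) _.
  have k1 : normc (a n - (q n z - q n w) / (z - w)) <= L * (normc z + normc w).
    by rewrite distcC; apply: qdiff; rewrite ?nz ?nw //; lra.
  have k2 : L * (normc z + normc w) <= e / 2 by apply: dP; rewrite ?nz ?nw; lra.
  lra.
exists m; apply: sdiff_punctured => [|e e0]; first exact: u_cont.
have [d /andP[d0 dr] dP] := small e e0; exists d => // z w.
rewrite /disc /= !subr0 => zd wd z0 w0 zw.
have zr : normc z < r by lra.
have wr : normc w < r by lra.
have lim2 : clim \oo (fun n => (q n z - q n w) / (z - w) - a n)
    ((u z - u w) / (z - w) - m).
  rewrite -[m]mul1r -mulNr.
  apply: clim_near (climD (qd_cvg z w z0 w0 zr wr) (climM (clim_cst _ (-1)) am)).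
  by apply: filterE => n /=; rewrite mulN1r.
apply: (clim_le lim2); apply: filterE => n /=.
apply: le_trans (dP _ _ zd wd); apply: qdiff => //; lra.
Qed.

End AtZero.

Lemma sdiff_shift (f : C -> C) a b l : sdiff f (a + b) l -> sdiff (fun z => f (z + b)) a l.
Proof.
move=> /sdiffP fl; apply/sdiffP => e /fl [d d0 dP]; exists d => // z w zd wd.
have sh x : disc a d x -> disc (a + b) d (x + b).
  by rewrite /disc /= opprD addrACA subrr addr0.
by have := dP _ _ (sh _ zd) (sh _ wd); rewrite opprD addrACA subrr addr0.
Qed.

Lemma hol_shift (f : C -> C) a (r : R) : hol (disc a r) f ->
  hol (disc 0 r) (fun z => f (z + a)).
Proof.
move=> fh z zr; have [|l fl] := fh (z + a); last by exists l; exact: sdiff_shift.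
by move: zr; rewrite /disc /= subr0 addrK.
Qed.

(** Only the behaviour at [a] needs Cauchy's formula: elsewhere the quotient is
   differentiated by the usual rules. *)
Lemma division (A : set C) (f : C -> C) a (r : R) : 0 < r -> disc a r `<=` A ->
  hol A f -> f a = 0 -> exists2 u, hol A u & forall z, f z = (z - a) * u z.
Proof.
move=> r0 rA fh fa; have Aa : A a by apply: rA; exact: disc_center.
have [l fl] := fh a Aa.
pose u z := if z == a then l else f z / (z - a).
exists u => [z Az|z]; last first.
  rewrite /u; case: eqVneq => [->|za]; first by rewrite subrr mul0r.
  by rewrite mulrC divfK // subr_eq0.
have [->|za] := eqVneq z a.
  pose g z := f (z + a).
  have g_hol : hol (disc 0 r) g by apply: hol_shift; exact: hol_sub fh.
  have gl : sdiff g 0 l by apply: sdiff_shift; rewrite add0r.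
  have r8 : 0 < r / 4 by rewrite divr_gt0.
  have r42 : 2 * (r / 4) < r by lra.
  have g0 : g 0 = 0 by rewrite /g add0r.
  have [m vm] := division0 g_hol r8 r42 g0 gl.
  exists m; have := @sdiff_shift _ a (- a) m; rewrite subrr => /(_ _ vm).
  apply: sdiff_near; apply: filterE => w /=.
  by rewrite /u subr_eq0 /g subrK.
have za0 : z - a != 0 by rewrite subr_eq0.
have [k fk] := fh z Az.
have dz := sdiffV (sdiffD (sdiff_id z) (sdiff_cst (- a) z)) za0.
eexists; apply: sdiff_near (sdiffM fk dz).
exists (normc (z - a)); first by rewrite normc_gt0.
move=> w; rewrite /disc /= /u; case: eqVneq => // ->.
by rewrite distcC ltxx.
Qed.

(** Cauchy's estimate bounds [u z] by a multiple of [r ^- m] that is uniform in [m],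
   hence [f z] by a multiple of [(normc z / r) ^+ m]. *)
Lemma vanish0 (f : C -> C) (rho r : R) : 0 < r -> 2 * r < rho -> hol (disc 0 rho) f ->
  (forall m, exists2 u, hol (disc 0 rho) u & forall z, f z = z ^+ m * u z) ->
  forall z, normc z < r -> f z = 0.
Proof.
move=> r0 r_rho fh fm z zr.
have [M M0 fM] := bounded_disc fh r_rho.
pose B := M * (r / (r - normc z)).
have rz : 0 < r - normc z by rewrite subr_gt0.
have B0 : 0 < B by rewrite /B mulr_gt0 // divr_gt0.
have key m : normc (f z) <= (normc z / r) ^+ m * B.
  have [u uh fu] := fm m; rewrite fu normcM normcX expr_div_n -mulrA.
  apply: ler_wpM2l; first by rewrite exprn_ge0 // normc_ge0.
  have rm : 0 < r ^+ m by rewrite exprn_gt0.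
  apply: (clim_le (discrete_cauchy uh r0 r_rho zr)); apply: filterE => n /=.
  apply: normc_cmean => // [|w wr]; first by apply: mulr_ge0; rewrite ?invr_ge0; exact: ltW.
  rewrite /B [leRHS]mulrA !normcM normcV wr; apply: ler_pM.
  - exact: normc_ge0.
  - by rewrite divr_ge0 ?normc_ge0 // ltW.
  - rewrite ler_pdivlMl // -wr -normcX -normcM -fu.
    by apply: fM; rewrite wr.
  rewrite ler_pM2l // lef_pV2 ?posrE //.
    by have := ler_normcD (w - z) z; rewrite subrK wr; lra.
  rewrite normc_gt0; apply: contraTneq zr => /subr0_eq <-.
  by rewrite wr ltxx.
apply: normc_small_eq0 => e e0.
have x1 : `|normc z / r| < 1.
  by rewrite ger0_norm ?divr_ge0 ?normc_ge0 ?(ltW r0) // ltr_pdivrMr // mul1r.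
have eB : 0 < e / B by rewrite divr_gt0.
move: x1 => /cvg_expr /cvgr0_norm_le /(_ _ eB) /filter_ex[m /= hm].
apply: le_trans (key m) _; rewrite -ler_pdivlMr //.
by apply: le_trans (ler_norm _) hm.
Qed.

(** Unless the zero has a finite order, division can be repeated forever. *)
Lemma order_or_vanish (A : set C) (f : C -> C) a (r : R) : 0 < r -> disc a r `<=` A ->
  hol A f ->
  (exists m u, [/\ hol A u, u a != 0 & forall z, f z = (z - a) ^+ m * u z]) \/
  (forall z, disc a (r / 4) z -> f z = 0).
Proof.
move=> r0 rA fh; have [?|no] := pselect (exists m u,
  [/\ hol A u, u a != 0 & forall z, f z = (z - a) ^+ m * u z]); first by left.
right; have allm m : exists2 u, hol A u & forall z, f z = (z - a) ^+ m * u z.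
  elim: m => [|m [u uh fu]]; first by exists f => // z; rewrite mul1r.
  have [ua|ua] := eqVneq (u a) 0; last by exfalso; apply: no; exists m, u.
  have [v vh uv] := division r0 rA uh ua.
  by exists v => // z; rewrite fu uv exprSr mulrA.
have gh : hol (disc 0 r) (fun z => f (z + a)) by apply: hol_shift; exact: hol_sub fh.
have r4 : 0 < r / 4 by rewrite divr_gt0.
have r42 : 2 * (r / 4) < r by lra.
move=> z zd; rewrite -[z](subrK a); apply: (vanish0 r4 r42 gh) => // m.
have [u uh fu] := allm m; exists (fun z => u (z + a)).
  by apply: hol_shift; exact: hol_sub uh.
by move=> w; rewrite fu addrK.
Qed.

(** Cancel the lower power of [z - a] off [a] and let [z] tend to [a]. *)
Lemma order_lt (f g : C -> C) a i j : ccont f a -> ccont g a -> (i < j)%N ->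
  cdnbhs a [set z | (z - a) ^+ i * f z = (z - a) ^+ j * g z] -> f a = 0.
Proof.
move=> fa ga ij fg.
have -> : 0 = (fun z => (z - a) ^+ (j - i) * g z) a :> C.
  by rewrite /= subrr expr0n subn_eq0 leqNgt ij mul0r.
have gc : ccont (fun z => (z - a) ^+ (j - i) * g z) a.
  apply: climM ga; apply: climX.
  exact: climD (ccont_id a) (clim_cst _ (- a)).
apply: (ccont_eq_dnbhs fa gc).
apply: filterS2 (cdnbhs_neq a) fg => z /=; rewrite -subr_eq0 => za.
have -> : (z - a) ^+ j = (z - a) ^+ i * (z - a) ^+ (j - i).
  by rewrite -exprD subnKC // ltnW.
by rewrite -mulrA; exact: (mulfI (expf_neq0 _ za)).
Qed.

Lemma order_neq0 (u : C -> C) a m : ccont u a -> u a != 0 ->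
  cdnbhs a [set z | (z - a) ^+ m * u z != 0].
Proof.
move=> uc ua; apply: filterS2 (cdnbhs_neq a) (cdnbhs_le (ccont_neq0 uc ua)) => z /=.
by rewrite -subr_eq0 => za uz; rewrite mulf_neq0 // expf_neq0.
Qed.

Lemma identity_disc (f : C -> C) a (r : R) : 0 < r -> hol (disc a r) f ->
  cnbhs a [set z | f z = 0] -> forall z, disc a (r / 4) z -> f z = 0.
Proof.
move=> r0 fh f0; have [[m [u [uh ua fu]]]|//] := order_or_vanish r0 (@subset_refl _ _) fh.
have uc := hol_cont uh (disc_center a r0).
have [z /= [fz]] := filter_ex (filterI (cdnbhs_le f0) (order_neq0 m uc ua)).
by rewrite -fu fz eqxx.
Qed.

End Division.

(** * Quaternions, slices and the star product *)

Section QuatAlgebra.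
Variable R : realType.
Local Notation C := R[i].
Implicit Types (p q I J : quat R) (z : R * R).

Lemma qcoordN p i : qcoord (- p) i = - qcoord p i.
Proof. by rewrite /qcoord mxE. Qed.

Lemma qcoordM p q :
  (qcoord (p * q) 0 = qcoord p 0 * qcoord q 0 - qcoord p 1 * qcoord q 1
                     - qcoord p 2 * qcoord q 2 - qcoord p 3 * qcoord q 3) *
  (qcoord (p * q) 1 = qcoord p 0 * qcoord q 1 + qcoord p 1 * qcoord q 0
                     + qcoord p 2 * qcoord q 3 - qcoord p 3 * qcoord q 2) *
  (qcoord (p * q) 2 = qcoord p 0 * qcoord q 2 - qcoord p 1 * qcoord q 3
                     + qcoord p 2 * qcoord q 0 + qcoord p 3 * qcoord q 1) *
  (qcoord (p * q) 3 = qcoord p 0 * qcoord q 3 + qcoord p 1 * qcoord q 2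
                     - qcoord p 2 * qcoord q 1 + qcoord p 3 * qcoord q 0).
Proof.
have -> : p * q = mkquat
   (qcoord p 0 * qcoord q 0 - qcoord p 1 * qcoord q 1
    - qcoord p 2 * qcoord q 2 - qcoord p 3 * qcoord q 3)
   (qcoord p 0 * qcoord q 1 + qcoord p 1 * qcoord q 0
    + qcoord p 2 * qcoord q 3 - qcoord p 3 * qcoord q 2)
   (qcoord p 0 * qcoord q 2 - qcoord p 1 * qcoord q 3
    + qcoord p 2 * qcoord q 0 + qcoord p 3 * qcoord q 1)
   (qcoord p 0 * qcoord q 3 + qcoord p 1 * qcoord q 2
    - qcoord p 2 * qcoord q 1 + qcoord p 3 * qcoord q 0) by [].
by rewrite !qcoord_mk.
Qed.

Lemma qcoord1 :
  (qcoord (1 : quat R) 0 = 1) * (qcoord (1 : quat R) 1 = 0) *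
  (qcoord (1 : quat R) 2 = 0) * (qcoord (1 : quat R) 3 = 0).
Proof.
have -> : (1 : quat R) = mkquat 1 0 0 0 by [].
by rewrite !qcoord_mk.
Qed.

Definition qcoordE := (qcoordN, qcoordD, qcoordZ, qcoordM, qcoord1, qcoord0, qcoord_mk).

Lemma imag_unitsP I : imag_units I <->
  qcoord I 0 = 0 /\ qcoord I 1 ^+ 2 + qcoord I 2 ^+ 2 + qcoord I 3 ^+ 2 = 1.
Proof.
rewrite /imag_units /= expr2; split=> [II|[I0 I1]]; last first.
  by apply: quatP; rewrite !qcoordE I0; move: I1; rewrite !expr2 => I1; lra.
have h0 := congr1 (fun q => qcoord q 0) II; have h1 := congr1 (fun q => qcoord q 1) II.
have h2 := congr1 (fun q => qcoord q 2) II; have h3 := congr1 (fun q => qcoord q 3) II.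
move: h0 h1 h2 h3; rewrite !qcoordE.
move: (qcoord I 0) (qcoord I 1) (qcoord I 2) (qcoord I 3) => a b c d h0 h1 h2 h3.
have a0 : a = 0.
  apply/eqP; apply: contraT => a0.
  have b0 : b = 0 by apply: (mulfI a0); lra.
  have c0 : c = 0 by apply: (mulfI a0); lra.
  have d0 : d = 0 by apply: (mulfI a0); lra.
  by have := sqr_ge0 a; rewrite expr2; move: h0; rewrite b0 c0 d0; lra.
by split => //; move: h0; rewrite a0 !expr2; lra.
Qed.

Lemma imag_unitsN I : imag_units I -> imag_units (- I).
Proof. by rewrite /imag_units /= sqrrN. Qed.

Lemma imag_units_conj p I : p != 0 -> imag_units I -> imag_units (p^-1 * I * p).
Proof.
move=> p0; rewrite /imag_units /= !expr2 => II.
by rewrite -!mulrA (mulrA p) divrr // mul1r (mulrA I) II mulN1r mulrN mulVr.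
Qed.

Lemma imag_units_neq0 I : imag_units I -> I != 0.
Proof.
move=> /imag_unitsP[_]; apply: contra_eq_neq => ->.
by rewrite !qcoord0 !expr0n /= !addr0 eq_sym oner_eq0.
Qed.

Lemma slice_ptN I z : slice_pt (- I) z = slice_pt I (z.1, - z.2).
Proof. by rewrite /slice_pt /= scalerN scaleNr. Qed.

Lemma slice_pt_re I z : imag_units I -> qre (slice_pt I z) = z.1.
Proof. by move=> /imag_unitsP[I0 _]; rewrite /qre /slice_pt !qcoordE I0; ring. Qed.

Lemma slice_pt_im I z : imag_units I -> qim (slice_pt I z) = z.2 *: I.
Proof. by move=> Iu; rewrite /qim slice_pt_re // /slice_pt addrAC subrr add0r. Qed.

Lemma qnormZ_imag (t : R) I : imag_units I -> qnorm (t *: I) = `|t|.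
Proof.
move=> /imag_unitsP[I0 I1].
have h : qnorm (t *: I) ^+ 2 = `|t| ^+ 2.
  rewrite qnorm_sqr !qcoordE I0 real_normK ?num_real // -[RHS]mulr1 -I1; ring.
by apply/eqP; rewrite -(@eqrXn2 _ 2) // ?h // sqrtr_ge0.
Qed.

Lemma slice_pt_norm_im I z : imag_units I -> qnorm (qim (slice_pt I z)) = `|z.2|.
Proof. by move=> Iu; rewrite slice_pt_im // qnormZ_imag. Qed.

Lemma slice_pt_inj I : imag_units I -> injective (slice_pt I).
Proof.
move=> Iu z w zw; have h1 : z.1 = w.1 by rewrite -(slice_pt_re z Iu) zw slice_pt_re.
have I0 := imag_units_neq0 Iu.
have : (z.2 - w.2) *: I = 0.
  by rewrite scalerBl -!slice_pt_im // zw subrr.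
move/eqP; rewrite scaler_eq0 (negbTE I0) orbF subr_eq0 => /eqP h2.
by rewrite [z]surjective_pairing [w]surjective_pairing h1 h2.
Qed.

Lemma circular_slice Omega I J z : circular Omega -> imag_units I -> imag_units J ->
  Omega (slice_pt I z) -> Omega (slice_pt J z).
Proof.
move=> circ Iu Ju Oz; apply: (circ _ Oz).
rewrite /sphere_of slice_pt_re // slice_pt_norm_im //.
have [z2|z2] := leP 0 z.2.
  by exists J => //; rewrite ger0_norm.
by exists (- J); [exact: imag_unitsN|rewrite ltr0_norm // scalerN scaleNr opprK].
Qed.

Lemma slice_repr q : exists2 I, imag_units I & q = slice_pt I (qre q, qnorm (qim q)).
Proof.
have im0 : qcoord (qim q) 0 = 0 by rewrite /qim /qre !qcoordE; ring.
have [n0|n0] := eqVneq (qnorm (qim q)) 0.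
  exists (mkquat 0 1 0 0).
    by apply/imag_unitsP; rewrite !qcoordE; split => //; ring.
  have : qim q == 0 by rewrite -qnorm_eq0 n0 expr0n.
  by rewrite /slice_pt /= n0 scale0r addr0 /qim subr_eq0 => /eqP.
exists ((qnorm (qim q))^-1 *: qim q); last first.
  by rewrite /slice_pt /= scalerA divff // scale1r /qim addrC subrK.
apply/imag_unitsP; rewrite !qcoordZ im0 mulr0; split => //.
have := qnorm_sqr (qim q); rewrite im0 expr0n add0r => h.
by rewrite !exprMn -!mulrDr -h -exprMn mulVf // expr1n.
Qed.

Lemma exists_imag : exists I, imag_units (I : quat R).
Proof.
exists (mkquat 0 1 0 0); apply/imag_unitsP; rewrite !qcoordE; split => //; ring.
Qed.

(** The conjugate [f(q)^-1 q f(q)] lies on the sphere of [q], with imaginary unit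
   [f(q)^-1 I f(q)]; multiplying by [f(q)] on the left brings [I] back.  Hence the
   star product multiplies stems as elements of the complexified quaternions, also
   at the zeroes of [f]. *)
Lemma star_stem I z (f g : quat R -> quat R) (a0 a1 b0 b1 : quat R) :
  imag_units I -> f (slice_pt I z) = a0 + I * a1 ->
  (forall J, imag_units J -> g (slice_pt J z) = b0 + J * b1) ->
  star f g (slice_pt I z) = (a0 * b0 - a1 * b1) + I * (a0 * b1 + a1 * b0).
Proof.
move=> Iu fE gE; have II : I * I = -1 by rewrite -expr2; exact: Iu.
have -> : (a0 * b0 - a1 * b1) + I * (a0 * b1 + a1 * b0) =
    (a0 + I * a1) * b0 + I * ((a0 + I * a1) * b1).
  rewrite mulrDr !mulrDl !mulrA [I * (_ + _)]mulrDr !mulrA II mulN1r mulNr.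
  by rewrite [I * a0 * b1 + _]addrC addrACA [- _ + _]addrC.
rewrite /star fE; case: eqVneq => [->|p0]; first by rewrite !mul0r mulr0 addr0.
move: (a0 + I * a1) p0 => p p0.
have -> : p^-1 * slice_pt I z * p = slice_pt (p^-1 * I * p) z.
  by rewrite /slice_pt mulrDr mulrDl -!(scalerAr, scalerAl) mulr1 mulVr.
rewrite gE; last exact: imag_units_conj.
by rewrite mulrDr !mulrA divrr // mul1r.
Qed.

End QuatAlgebra.

(** * From the Cauchy-Riemann equations to strict differentiability *)

Section Bridge.
Variable R : realType.
Local Notation C := R[i].

Definition rpt (c : C) : R * R := (complex.Re c, complex.Im c).
Definition cpt (z : R * R) : C := z.1 +i* z.2.

Local Notation e1 := ((1, 0) : R * R).
Local Notation e2 := ((0, 1) : R * R).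

Lemma cptK z : rpt (cpt z) = z. Proof. by case: z. Qed.
Lemma rptK c : cpt (rpt c) = c. Proof. by case: c. Qed.

Lemma nbhs_cnbhs (c : C) (P : set (R * R)) :
  nbhs (rpt c) P -> cnbhs c [set w | P (rpt w)].
Proof.
move=> /nbhs_ballP[d /= d0 dP]; exists d => // w wd; apply: dP.
rewrite /ball /= /prod_ball /=; split; rewrite /ball /= -raddfB.
  by apply: le_lt_trans (normc_Re _) _; rewrite distcC.
by apply: le_lt_trans (normc_Im _) _; rewrite distcC.
Qed.

Lemma cnbhs_nbhs (z : R * R) (P : set C) :
  cnbhs (cpt z) P -> nbhs z [set w | P (cpt w)].
Proof.
move=> [d d0 dP]; apply/nbhs_ballP; exists (d / 2); first by rewrite /= divr_gt0.
move=> w [/= h1 h2]; apply: dP; rewrite /disc /=.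
apply: le_lt_trans (normc_le_ReIm (cpt w - cpt z)) _ => /=.
by move: h1 h2; rewrite /ball /= distrC [`|z.2 - _|]distrC; lra.
Qed.

Lemma slice_pt_continuous (I : quat R) : continuous (slice_pt I).
Proof.
move=> z; apply: cvgD.
  by apply: cvgZr_tmp; exact: cvg_fst.
by apply: cvgZr_tmp; exact: cvg_snd.
Qed.

Lemma mvt_ineq (h : R -> R) (a e x y : R) :
  (forall t, (x <= t <= y) || (y <= t <= x) -> derivable h t 1 /\ `|'D_1 h t - a| <= e) ->
  `|h x - h y - a * (x - y)| <= e * `|x - y|.
Proof.
wlog xy : x y / x <= y => [wl|].
  have [xy|/ltW yx] := leP x y; first exact: wl.
  move=> ht; have := wl y x yx; rewrite distrC [`|y - x|]distrC => H.
  have -> : h x - h y - a * (x - y) = a * (y - x) - (h y - h x) by ring.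
  by apply: H => t; rewrite orbC; exact: ht.
move=> ht.
have hd t : t \in `[x, y] -> derivable h t 1 /\ `|'D_1 h t - a| <= e.
  by rewrite in_itv /= => txy; apply: ht; rewrite txy.
have [||c cxy hc] := @MVT_segment R h ('D_1 h) x y xy.
- move=> t txy; apply: DeriveDef => //.
  by have [] := hd t (subset_itv_oo_cc txy).
- apply: derivable_within_continuous => t txy.
  by have [] := hd t txy.
have [_ hca] := hd c cxy.
have -> : h x - h y - a * (x - y) = - ((h y - h x) - a * (y - x)) by ring.
by rewrite hc -mulrBl normrN normrM [`|x - y|]distrC ler_wpM2r.
Qed.

Lemma quotient_fst (u : R * R -> R) x y :
  (fun h : R => h^-1 *: (u (h *: e1 + (x, y)) - u (x, y))) =
  (fun h : R => h^-1 *: (u (h *: 1 + x, y) - u (x, y))).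
Proof.
apply/funext => h; congr (_ *: (u _ - _)).
have -> : h *: e1 + (x, y) = (h * 1 + x, h * 0 + y) :> R * R by [].
by rewrite mulr0 add0r.
Qed.

Lemma quotient_snd (u : R * R -> R) x y :
  (fun h : R => h^-1 *: (u (h *: e2 + (x, y)) - u (x, y))) =
  (fun h : R => h^-1 *: (u (x, h *: 1 + y) - u (x, y))).
Proof.
apply/funext => h; congr (_ *: (u _ - _)).
have -> : h *: e2 + (x, y) = (h * 0 + x, h * 1 + y) :> R * R by [].
by rewrite mulr0 add0r.
Qed.

Lemma partial_fst (u : R * R -> R) x y : derivable u (x, y) e1 ->
  derivable (fun t => u (t, y)) x 1 /\ 'D_1 (fun t => u (t, y)) x = 'D_e1 u (x, y).
Proof. by rewrite /derivable /derive /= quotient_fst. Qed.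

Lemma partial_snd (u : R * R -> R) x y : derivable u (x, y) e2 ->
  derivable (fun t => u (x, t)) y 1 /\ 'D_1 (fun t => u (x, t)) y = 'D_e2 u (x, y).
Proof. by rewrite /derivable /derive /= quotient_snd. Qed.

(** Go from one point to the other along the two axes and apply the mean value
   inequality on each segment. *)
Lemma C1_strict (u : R * R -> R) (z0 : R * R) (a b : R) :
  (\forall z \near z0, derivable u z e1 /\ derivable u z e2) ->
  'D_e1 u z @[z --> z0] --> a -> 'D_e2 u z @[z --> z0] --> b ->
  forall e : R, 0 < e -> exists2 d : R, 0 < d &
    forall z w : R * R, ball z0 d z -> ball z0 d w ->
    `|u z - u w - (a * (z.1 - w.1) + b * (z.2 - w.2))| <=
      e * (`|z.1 - w.1| + `|z.2 - w.2|).
Proof.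
move=> der /cvgrPdist_le ca /cvgrPdist_le cb e e0.
have [d /= d0 dP] : nbhs_ball z0 [set z | [/\ derivable u z e1, derivable u z e2,
    `|a - 'D_e1 u z| <= e & `|b - 'D_e2 u z| <= e]].
  apply/nbhs_ballP; apply: filterS3 der (ca e e0) (cb e e0) => z [h1 h2] h3 h4.
  exact: And4.
exists d => // z w [z1 z2] [w1 w2].
have between (p x y t : R) : ball p d x -> ball p d y ->
    (x <= t <= y) || (y <= t <= x) -> ball p d t.
  by rewrite /ball /= !ltr_norml => /andP[? ?] /andP[? ?] /orP[] /andP[? ?]; lra.
have h1 := @mvt_ineq (fun t => u (t, z.2)) a e z.1 w.1.
have h2 := @mvt_ineq (fun t => u (w.1, t)) b e z.2 w.2.
have {}h1 : `|u (z.1, z.2) - u (w.1, z.2) - a * (z.1 - w.1)| <= e * `|z.1 - w.1|.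
  apply: h1 => t tb; have [|k1 k2 k3 k4] := dP (t, z.2).
    by split => //=; exact: between tb.
  have [j1 ->] := partial_fst k1; rewrite distrC.
  exact: conj.
have {}h2 : `|u (w.1, z.2) - u (w.1, w.2) - b * (z.2 - w.2)| <= e * `|z.2 - w.2|.
  apply: h2 => t tb; have [|k1 k2 k3 k4] := dP (w.1, t).
    by split => //=; exact: between tb.
  have [j1 ->] := partial_snd k2; rewrite distrC.
  exact: conj.
move: h1 h2; rewrite -!surjective_pairing => h1 h2.
have -> : u z - u w - (a * (z.1 - w.1) + b * (z.2 - w.2)) =
  (u z - u (w.1, z.2) - a * (z.1 - w.1)) + (u (w.1, z.2) - u w - b * (z.2 - w.2)) by ring.
by apply: le_trans (ler_normD _ _) _; rewrite [leRHS]mulrDr; exact: lerD.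
Qed.

(** The Cauchy-Riemann equations say that the two real differentials are together
   the multiplication by a complex number. *)
Lemma CR_sdiff (u v : R * R -> R) (f : C -> C) c :
  (forall z, f z = u (rpt z) +i* v (rpt z)) ->
  (\forall z \near rpt c, derivable u z e1 /\ derivable u z e2) ->
  (\forall z \near rpt c, derivable v z e1 /\ derivable v z e2) ->
  {for rpt c, continuous ('D_e1 u)} -> {for rpt c, continuous ('D_e2 u)} ->
  {for rpt c, continuous ('D_e1 v)} -> {for rpt c, continuous ('D_e2 v)} ->
  'D_e1 u (rpt c) = 'D_e2 v (rpt c) ->
  'D_e2 u (rpt c) = - 'D_e1 v (rpt c) ->
  sdiff f c ('D_e1 u (rpt c) +i* 'D_e1 v (rpt c)).
Proof.
move=> fE du dv u1 u2 v1 v2 CR1 CR2; apply/sdiffP => e e0.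
have e4 : 0 < e / 4 by lra.
have [d1 d10 P1] := C1_strict du u1 u2 e4.
have [d2 d20 P2] := C1_strict dv v1 v2 e4.
exists (Num.min d1 d2); first by rewrite lt_min d10.
have toball (d : R) z : normc (z - c) < d -> ball (rpt c) d (rpt z).
  move=> zd; split; rewrite /ball /= -raddfB.
    by apply: le_lt_trans (normc_Re _) _; rewrite distcC.
  by apply: le_lt_trans (normc_Im _) _; rewrite distcC.
move=> z w; rewrite /disc /= !lt_min => /andP[z1 z2] /andP[w1 w2].
have := P1 _ _ (toball _ _ z1) (toball _ _ w1).
have := P2 _ _ (toball _ _ z2) (toball _ _ w2).
rewrite CR2 -CR1; set a := 'D_e1 u _; set b := 'D_e1 v _.
have k1 : `|complex.Re z - complex.Re w| <= normc (z - w).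
  by rewrite -raddfB; exact: normc_Re.
have k2 : `|complex.Im z - complex.Im w| <= normc (z - w).
  by rewrite -raddfB; exact: normc_Im.
rewrite !fE => h2 h1; apply: le_trans (normc_le_ReIm _) _.
have -> : complex.Re (u (rpt z) +i* v (rpt z) - (u (rpt w) +i* v (rpt w))
    - (a +i* b) * (z - w)) =
   u (rpt z) - u (rpt w) - (a * ((rpt z).1 - (rpt w).1) + - b * ((rpt z).2 - (rpt w).2)).
  by case: z w {z1 z2 w1 w2 h1 h2 k1 k2} => [x y] [x' y'] /=; ring.
have -> : complex.Im (u (rpt z) +i* v (rpt z) - (u (rpt w) +i* v (rpt w))
    - (a +i* b) * (z - w)) =
   v (rpt z) - v (rpt w) - (b * ((rpt z).1 - (rpt w).1) + a * ((rpt z).2 - (rpt w).2)).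
  by case: z w {z1 z2 w1 w2 h1 h2 k1 k2} => [x y] [x' y'] /=; ring.
move: h1 h2 => /= h1 h2.
apply: le_trans (lerD h1 h2) _.
have -> : e * normc (z - w) = e / 4 * (normc (z - w) + normc (z - w))
  + e / 4 * (normc (z - w) + normc (z - w)) by field.
by rewrite !lerD // ler_pM2l // lerD.
Qed.

End Bridge.

(** * The complex components of a regular stem *)

Section StemHolomorphy.
Variable R : realType.
Local Notation C := R[i].
Implicit Types (Omega : set (quat R)) (F : R * R -> quat R).

Local Notation e1 := ((1, 0) : R * R).
Local Notation e2 := ((0, 1) : R * R).

Definition cdom Omega : set C := [set c | stem_dom Omega (rpt c)].

Definition stem_comp F0 F1 (k : nat) (c : C) : C :=
  qcoord (F0 (rpt c)) k +i* qcoord (F1 (rpt c)) k.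

(** It suffices to move the point in the slice that witnesses its membership. *)
Lemma stem_dom_near Omega (z : R * R) : open Omega -> stem_dom Omega z ->
  nbhs z (stem_dom Omega).
Proof.
move=> Oo [I Iu Oz].
have : nbhs z (slice_pt I @^-1` Omega).
  by apply: slice_pt_continuous; exact: open_nbhs_nbhs.
by apply: filterS => w Ow; exists I.
Qed.

Lemma cdom_near Omega c : open Omega -> cdom Omega c -> cnbhs c (cdom Omega).
Proof. by move=> Oo /(stem_dom_near Oo) /nbhs_cnbhs. Qed.

Lemma qcoord_continuous k : continuous (fun q : quat R => qcoord q k).
Proof. by move=> q; exact: (@coord_continuous _ 1 4 0 (inord k)). Qed.

Lemma derivable_qcoord F k z (v : R * R) : derivable F z v ->
  derivable (fun w => qcoord (F w) k) z v /\
  'D_v (fun w => qcoord (F w) k) z = qcoord ('D_v F z) k.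
Proof.
move=> dF; split; first exact: ((derivable_mxP F z v).1 dF 0 (inord k)).
by rewrite /qcoord (derive_mx dF) mxE.
Qed.

Lemma partial_continuous F k z (v : R * R) :
  (\forall w \near z, derivable F w v) -> {for z, continuous ('D_v F)} ->
  {for z, continuous ('D_v (fun w => qcoord (F w) k))}.
Proof.
move=> dF cF; have dFz := nbhs_singleton dF.
rewrite /prop_for /continuous_at (derivable_qcoord k dFz).2.
have h : qcoord ('D_v F w) k @[w --> z] --> qcoord ('D_v F z) k.
  have := @continuous_comp _ _ _ ('D_v F) (fun q : quat R => qcoord q k) z cF
    (@qcoord_continuous k _).
  exact.
apply: cvg_trans h; apply: near_eq_cvg.
by apply: filterS dF => w dw; rewrite (derivable_qcoord k dw).2.
Qed.

(** The regularity of a stem bears on its four coordinates separately, each of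
   which is an ordinary holomorphic function. *)
Lemma stem_hol Omega F0 F1 k : open Omega -> regular_stem Omega F0 F1 ->
  hol (cdom Omega) (stem_comp F0 F1 k).
Proof.
move=> Oo [C0 C1 _ CR] c Dc.
have near_dom := stem_dom_near Oo Dc.
have d00 : \forall w \near rpt c, derivable F0 w e1.
  by apply: filterS near_dom => w Dw; have [h _ _ _] := C0 w Dw; exact: h.
have d01 : \forall w \near rpt c, derivable F0 w e2.
  by apply: filterS near_dom => w Dw; have [_ h _ _] := C0 w Dw; exact: h.
have d10 : \forall w \near rpt c, derivable F1 w e1.
  by apply: filterS near_dom => w Dw; have [h _ _ _] := C1 w Dw; exact: h.
have d11 : \forall w \near rpt c, derivable F1 w e2.
  by apply: filterS near_dom => w Dw; have [_ h _ _] := C1 w Dw; exact: h.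
have [_ _ c00 c01] := C0 _ Dc; have [_ _ c10 c11] := C1 _ Dc.
have [CR1 CR2] := CR _ Dc.
have fE w : stem_comp F0 F1 k w = qcoord (F0 (rpt w)) k +i* qcoord (F1 (rpt w)) k.
  exact: erefl.
have du : \forall w \near rpt c, derivable (fun x => qcoord (F0 x) k) w e1 /\
    derivable (fun x => qcoord (F0 x) k) w e2.
  apply: filterS2 d00 d01 => w h1 h2.
  exact: conj (derivable_qcoord k h1).1 (derivable_qcoord k h2).1.
have dv : \forall w \near rpt c, derivable (fun x => qcoord (F1 x) k) w e1 /\
    derivable (fun x => qcoord (F1 x) k) w e2.
  apply: filterS2 d10 d11 => w h1 h2.
  exact: conj (derivable_qcoord k h1).1 (derivable_qcoord k h2).1.
have E00 := (derivable_qcoord k (nbhs_singleton d00)).2.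
have E01 := (derivable_qcoord k (nbhs_singleton d01)).2.
have E10 := (derivable_qcoord k (nbhs_singleton d10)).2.
have E11 := (derivable_qcoord k (nbhs_singleton d11)).2.
have CRk1 : 'D_e1 (fun x => qcoord (F0 x) k) (rpt c) =
            'D_e2 (fun x => qcoord (F1 x) k) (rpt c).
  by rewrite E00 E11; congr qcoord.
have CRk2 : 'D_e2 (fun x => qcoord (F0 x) k) (rpt c) =
          - 'D_e1 (fun x => qcoord (F1 x) k) (rpt c).
  by rewrite E01 E10 -qcoordN; congr qcoord.
have p1 := @partial_continuous _ k _ _ d00 c00.
have p2 := @partial_continuous _ k _ _ d01 c01.
have p3 := @partial_continuous _ k _ _ d10 c10.
have p4 := @partial_continuous _ k _ _ d11 c11.
eexists; exact: (CR_sdiff fE du dv p1 p2 p3 p4 CRk1 CRk2).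
Qed.

End StemHolomorphy.

(** * Regular stems from holomorphic components *)

Section StemOfHolomorphic.
Variable R : realType.
Local Notation C := R[i].
Local Notation e1 := ((1, 0) : R * R).
Local Notation e2 := ((0, 1) : R * R).
Implicit Types (Omega : set (quat R)) (z v : R * R).

Lemma cvg_row (T : Type) (F : set_system T) {FF : Filter F}
    (f : 'I_4 -> T -> R) (l : 'I_4 -> R) :
  (forall k, f k x @[x --> F] --> l k) ->
  ((\row_(k < 4) f k x : quat R) @[x --> F] --> (\row_(k < 4) l k : quat R)).
Proof.
move=> fl; apply/cvgrPdist_le => e e0.
have near_all : \forall x \near F, forall k : 'I_4, `|l k - f k x| <= e.
  by apply: filter_forall => k; move/cvgrPdist_le: (fl k) => /(_ _ e0).
apply: filterS near_all => x xk.
rewrite [leLHS]/Num.Def.normr /= mx_normrE (bigmax_le _ (ltW e0)) //= => -[i j] _.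
by rewrite !mxE.
Qed.

(** What the real and the imaginary part have in common, so that the two parts of a
   stem are treated by the same lemmas. *)
Definition real_form (phi : C -> R) :=
  [/\ {morph phi : x y / x - y}, forall (t : R) x, phi (t%:C * x) = t * phi x
    & forall x, `|phi x| <= normc x].

Lemma real_form_Re : real_form (@complex.Re R).
Proof.
split=> [x y|t [x y]|x]; [exact: raddfB|by rewrite /= mul0r subr0|exact: normc_Re].
Qed.

Lemma real_form_Im : real_form (@complex.Im R).
Proof.
split=> [x y|t [x y]|x]; [exact: raddfB|by rewrite /= mul0r addr0|exact: normc_Im].
Qed.

Definition qstem (phi : C -> R) (f : nat -> C -> C) (z : R * R) : quat R :=
  \row_(k < 4) phi (f k (cpt z)).

Lemma qcoord_qstem phi f z k : (k < 4)%N -> qcoord (qstem phi f z) k = phi (f k (cpt z)).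
Proof. by move=> k4; rewrite /qcoord mxE inordK. Qed.

Lemma real_form_cvg phi (g : C -> C) z : real_form phi -> ccont g (cpt z) ->
  phi (g (cpt w)) @[w --> z] --> phi (g (cpt z)).
Proof.
move=> [phiB _ phi_le] gc; apply/cvgrPdist_le => e e0.
apply: filterS (cnbhs_nbhs (gc _ e0)) => w /= h.
by rewrite -phiB; apply: le_trans (phi_le _) _; rewrite distcC.
Qed.

Lemma qstem_continuous phi g z : real_form phi ->
  (forall k, (k < 4)%N -> ccont (g k) (cpt z)) -> {for z, continuous (qstem phi g)}.
Proof.
move=> phiF gc.
have h (k : 'I_4) := real_form_cvg phiF (gc k (ltn_ord k)).
exact: (cvg_row h).
Qed.

Lemma cptD (z v : R * R) (h : R) : cpt (h *: v + z) = cpt z + h%:C * cpt v.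
Proof.
have -> : h *: v + z = (h * v.1 + z.1, h * v.2 + z.2) by case: z v => ? ? [? ?].
by apply/eqP; rewrite eq_complex /=; apply/andP; split; apply/eqP; ring.
Qed.

Lemma real_form_quotient phi (f : C -> C) l z v : real_form phi -> sdiff f (cpt z) l ->
  h^-1 *: (phi (f (cpt (h *: v + z))) - phi (f (cpt z))) @[h --> 0^'] --> phi (l * cpt v).
Proof.
move=> [phiB phiZ phi_le] /sdiffP fl; apply/cvgrPdist_le => e e0.
have V0 : 0 < normc (cpt v) + 1 by have := normc_ge0 (cpt v); lra.
have eV : 0 < e / (normc (cpt v) + 1) by rewrite divr_gt0.
have [d d0 dP] := fl _ eV.
have dV : 0 < d / (normc (cpt v) + 1) by rewrite divr_gt0.
near=> h; have h0 : h != 0 by near: h; exact: nbhs_dnbhs_neq.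
have hd : `|h| < d / (normc (cpt v) + 1) by near: h; exact: dnbhs0_lt.
have hn : 0 < `|h| by rewrite normr_gt0.
have hv : normc (h%:C * cpt v) <= `|h| * (normc (cpt v) + 1).
  by rewrite normcM normc_real ler_wpM2l //; lra.
have dz : cpt (h *: v + z) - cpt z = h%:C * cpt v by rewrite cptD; ring.
have zd : disc (cpt z) d (cpt (h *: v + z)).
  rewrite /disc /mkset dz; apply: le_lt_trans hv _.
  by rewrite -ltr_pdivlMr.
have := dP _ _ zd (disc_center _ d0); rewrite dz => bound.
rewrite distrC -(ler_pM2l hn) -normrM.
have -> : h * (h^-1 *: (phi (f (cpt (h *: v + z))) - phi (f (cpt z))) - phi (l * cpt v)) =
    phi (f (cpt (h *: v + z)) - f (cpt z) - l * (h%:C * cpt v)).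
  rewrite !phiB [l * (_ * _)]mulrCA phiZ /GRing.scale /= mulrBr mulrA divff // mul1r.
  by [].
apply: le_trans (phi_le _) _; apply: le_trans bound _.
apply: le_trans (ler_wpM2l (ltW eV) hv) _.
by rewrite le_eqVlt; apply/orP; left; apply/eqP; field; rewrite gt_eqF.
Unshelve. all: by end_near.
Qed.

Definition cderiv (f : C -> C) (c : C) : C := xget 0 [set l | sdiff f c l].

Lemma cderivP (A : set C) (f : C -> C) c : hol A f -> A c -> sdiff f c (cderiv f c).
Proof. by move=> fh /fh [l fl]; exact: (xgetPex 0 (ex_intro _ l fl)). Qed.

(** A strict derivative at [c] approximates all difference quotients near [c], hence
   also the derivatives at the points near [c]. *)
Lemma cderiv_cont (f : C -> C) c : cnbhs c [set x | exists l, sdiff f x l] ->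
  ccont (cderiv f) c.
Proof.
move=> fh; have fz (x : C) : (exists l, sdiff f x l) -> sdiff f x (cderiv f x).
  by move=> [l fl]; exact: (xgetPex 0 (ex_intro _ l fl)).
move=> e e0; have [d d0 dP] := fz _ (cnbhs_at fh) e e0.
have near_c : cnbhs c [set x | disc c d x] by exact: cnbhs_disc.
apply: filterS2 fh (cnbhs_near near_c) => z /= /fz zl zd.
rewrite -[cderiv f z]addr0 -addrA [0 + _]add0r.
apply: (@clim_le _ _ (offdiag z) _ (fun p => (f p.1 - f p.2) / (p.1 - p.2) - cderiv f c)).
  exact: climD zl (clim_cst _ _).
apply: filterS3 (offdiag_fst zd) (offdiag_snd zd) (offdiag_neq z) => p h1 h2 h3.
exact: dP.
Qed.

Lemma qstem_derive phi f l z v : real_form phi ->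
  (forall k, (k < 4)%N -> sdiff (f k) (cpt z) (l k)) ->
  derivable (qstem phi f) z v /\
  'D_v (qstem phi f) z = \row_(k < 4) phi (l k * cpt v).
Proof.
move=> phiF fl.
have h (k : 'I_4) := real_form_quotient (v := v) phiF (fl k (ltn_ord k)).
have lim : h^-1 *: (qstem phi f (h *: v + z) - qstem phi f z) @[h --> 0^'] -->
    (\row_(k < 4) phi (l k * cpt v) : quat R).
  have -> : (fun h => h^-1 *: (qstem phi f (h *: v + z) - qstem phi f z)) =
     (fun h => \row_(k < 4)
        (h^-1 *: (phi (f k (cpt (h *: v + z))) - phi (f k (cpt z)))) : quat R).
    by apply/funext => t; apply/rowP => k; rewrite !mxE.
  exact: (cvg_row h).
split; first exact: (cvgP _ lim).
exact: (cvg_lim (@norm_hausdorff _ _) lim).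
Qed.

(** Both directional derivatives are values of one complex derivative, along [1] and
   along the imaginary unit; the Cauchy-Riemann equations express just this. *)
Lemma hol_regular_stem Omega (f : nat -> C -> C) : open Omega ->
  (forall k, (k < 4)%N -> hol (cdom Omega) (f k)) ->
  (forall k c, (k < 4)%N -> cdom Omega c -> f k c^* = (f k c)^*) ->
  regular_stem Omega (qstem (@complex.Re R) f) (qstem (@complex.Im R) f).
Proof.
move=> Oo fh fconj.
have inC z : stem_dom Omega z -> cdom Omega (cpt z) by rewrite /cdom /= cptK.
have fd z k : stem_dom Omega z -> (k < 4)%N -> sdiff (f k) (cpt z) (cderiv (f k) (cpt z)).
  by move=> /inC Dz k4; exact: cderivP (fh k k4) Dz.
have der phi v z : real_form phi -> stem_dom Omega z ->
    derivable (qstem phi f) z v /\ 'D_v (qstem phi f) z =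
      qstem phi (fun k c => cderiv (f k) c * cpt v) z.
  by move=> phiF Dz; exact: (qstem_derive v phiF (fun k => @fd z k Dz)).
have cont phi v z : real_form phi -> stem_dom Omega z ->
    {for z, continuous ('D_v (qstem phi f))}.
  move=> phiF Dz.
  have gc k : (k < 4)%N -> ccont (fun c => cderiv (f k) c * cpt v) (cpt z).
    move=> k4; apply: climM (clim_cst _ _); apply: cderiv_cont.
    by apply: filterS (cdom_near Oo (inC _ Dz)) => c /(fh k k4).
  have h := qstem_continuous phiF gc.
  rewrite /prop_for /continuous_at (der phi v z phiF Dz).2.
  apply: cvg_trans h; apply: near_eq_cvg.
  by apply: filterS (stem_dom_near Oo Dz) => w Dw; rewrite (der phi v w phiF Dw).2.
have fRe := real_form_Re; have fIm := real_form_Im.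
split.
- move=> z Dz; apply: And4.
  + exact: (der _ _ _ fRe Dz).1.
  + exact: (der _ _ _ fRe Dz).1.
  + exact: cont.
  + exact: cont.
- move=> z Dz; apply: And4.
  + exact: (der _ _ _ fIm Dz).1.
  + exact: (der _ _ _ fIm Dz).1.
  + exact: cont.
  + exact: cont.
- move=> z Dz; have cz : cpt (z.1, - z.2) = (cpt z)^* by [].
  have fz (k : 'I_4) : f k (cpt z)^* = (f k (cpt z))^* := fconj k _ (ltn_ord k) (inC _ Dz).
  by split; apply/rowP => k; rewrite !mxE cz fz; case: (f k (cpt z)).
- move=> z Dz; rewrite /d_alpha /d_beta.
  rewrite (der _ e1 _ fRe Dz).2 (der _ e2 _ fRe Dz).2.
  rewrite (der _ e1 _ fIm Dz).2 (der _ e2 _ fIm Dz).2.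
  by split; apply/rowP => k; rewrite !mxE; case: (cderiv _ _) => a b /=; ring.
Qed.

End StemOfHolomorphic.

(** * Stems, slice conjugates and symmetrized functions *)

Section StemAlgebra.
Variable R : realType.
Local Notation C := R[i].
Implicit Types (Omega : set (quat R)) (I J q : quat R) (F G : R * R -> quat R).
Implicit Types (f g h : quat R -> quat R).

Lemma slice_ptM I (c d : C) : imag_units I ->
  slice_pt I (rpt c) * slice_pt I (rpt d) = slice_pt I (rpt (c * d)).
Proof.
rewrite /imag_units /= expr2 => II; case: c d => [a b] [a' b'].
rewrite /slice_pt /= mulrDl !mulrDr -!scalerAl -!scalerAr !mul1r mulr1 II.
rewrite !scalerDl !scalerN !scalerA scaleNr -!addrA; congr (_ + _).
rewrite addrA addrC; congr (_ + _); rewrite ?addrC //.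
Qed.

Lemma slice_ptX I (c : C) n : imag_units I ->
  slice_pt I (rpt c) ^+ n = slice_pt I (rpt (c ^+ n)).
Proof.
move=> Iu; elim: n => [|n ih]; last by rewrite !exprS ih slice_ptM.
by rewrite !expr0 /slice_pt /= scale1r scale0r addr0.
Qed.

Lemma slice_pt_eq0 I (c : C) : imag_units I -> (slice_pt I (rpt c) == 0) = (c == 0).
Proof.
move=> Iu; have s0 : slice_pt I (rpt 0) = 0 by rewrite /slice_pt /= !scale0r addr0.
apply/eqP/eqP => [h|->]; last exact: s0.
by rewrite -[c]rptK (slice_pt_inj Iu (etrans h (esym s0))) rptK.
Qed.

Lemma slice_mul_stem I (d : C) (a0 a1 : quat R) : imag_units I ->
  slice_pt I (rpt d) * (a0 + I * a1) =
  (complex.Re d *: a0 - complex.Im d *: a1) + I * (complex.Re d *: a1 + complex.Im d *: a0).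
Proof.
rewrite /imag_units /= expr2 => II.
rewrite /slice_pt /= mulrDl !mulrDr -!scalerAl !mul1r mulrA II mulN1r scalerN.
rewrite -!scalerAr -!addrA; congr (_ + _).
by rewrite addrA addrC.
Qed.

(** Add and subtract the equations for [I] and [- I]. *)
Lemma stem_inj (a0 a1 b0 b1 : quat R) :
  (forall I, imag_units I -> a0 + I * a1 = b0 + I * b1) -> a0 = b0 /\ a1 = b1.
Proof.
have [I Iu] := exists_imag R => eqI.
have h1 := eqI _ Iu; have h2 := eqI _ (imag_unitsN Iu).
have half (x y u v : quat R) : x + y = u + v -> x - y = u - v -> x = u.
  move=> e1 e2; have k1 i := congr1 (fun q => qcoord q i) e1.
  have k2 i := congr1 (fun q => qcoord q i) e2.
  apply: quatP; [move: (k1 0%N) (k2 0%N)|move: (k1 1%N) (k2 1%N)|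
    move: (k1 2%N) (k2 2%N)|move: (k1 3%N) (k2 3%N)];
    rewrite !(qcoordD, qcoordN); lra.
have e0 : a0 = b0 by apply: half h1 _; move: h2; rewrite !mulNr.
split => //; have I_unit : I \is a GRing.unit := imag_units_neq0 Iu.
by apply: (mulrI I_unit); apply: (addrI a0); rewrite h1 e0.
Qed.

Lemma induced_all Omega F0 F1 f z : circular Omega -> induced_by Omega F0 F1 f ->
  stem_dom Omega z -> forall I, imag_units I -> f (slice_pt I z) = F0 z + I * F1 z.
Proof. by move=> circ ind [J Ju Oz] I Iu; apply: ind => //; exact: circular_slice Oz. Qed.

Lemma stem_dom_slice Omega I z : circular Omega -> imag_units I -> stem_dom Omega z ->
  Omega (slice_pt I z).
Proof. by move=> circ Iu [J Ju Oz]; exact: circular_slice Oz. Qed.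

(** At a real point [b] is [0], and so is the second term, as it must be: a stem of
   the right parity has [F1 = 0] there. *)
Definition from_stem F0 F1 q : quat R :=
  let b := qnorm (qim q) in F0 (qre q, b) + (b^-1 *: qim q) * F1 (qre q, b).

Definition stem_parity Omega F0 F1 := forall z, stem_dom Omega z ->
  F0 (z.1, - z.2) = F0 z /\ F1 (z.1, - z.2) = - F1 z.

Lemma from_stemP Omega F0 F1 : stem_parity Omega F0 F1 ->
  induced_by Omega F0 F1 (from_stem F0 F1).
Proof.
move=> par I z Iu Oz; rewrite /from_stem slice_pt_re // slice_pt_norm_im // slice_pt_im //.
have [p0 p1] : F0 (z.1, - z.2) = F0 z /\ F1 (z.1, - z.2) = - F1 z by apply: par; exists I.
have [z2|z2|z2] := ltrgt0P z.2.
- by rewrite scalerA mulVf ?gt_eqF // scale1r -surjective_pairing.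
- by rewrite p0 p1 scalerA invrN mulNr mulVf ?lt_eqF // scaleN1r mulrNN.
- rewrite z2 !scale0r scaler0 mul0r addr0.
  have z0 : (z.1, 0) = z by rewrite [RHS]surjective_pairing z2.
  move: p1; rewrite z2 oppr0 z0 => p1.
  have F10 : F1 z = 0.
    have k i := congr1 (fun q => qcoord q i) p1.
    by apply: quatP; move: (k 0%N) (k 1%N) (k 2%N) (k 3%N); rewrite !(qcoordN, qcoord0); lra.
  by rewrite F10 mulr0 addr0.
Qed.

Lemma qconjN q : qconj (- q) = - qconj q.
Proof. by apply: quatP; rewrite !qcoord_conj !qcoordE. Qed.

(** The function [f] determines its stem on the domain, so that the stem hidden in the
   choice made by [slice_conj] is the given one. *)
Lemma slice_conjE Omega F0 F1 f z I : circular Omega -> regular_stem Omega F0 F1 ->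
  induced_by Omega F0 F1 f -> imag_units I -> stem_dom Omega z ->
  slice_conj Omega f (slice_pt I z) = qconj (F0 z) + I * qconj (F1 z).
Proof.
move=> circ Freg Find Iu Dz.
have [_ _ par _] := Freg.
have cpar : stem_parity Omega (qconj (R:=R) \o F0) (qconj (R:=R) \o F1).
  by move=> w /par[p0 p1] /=; rewrite p0 p1 qconjN.
have [E0 [E1 [Ereg Eind cind]]] : exists E0 E1,
    [/\ regular_stem Omega E0 E1, induced_by Omega E0 E1 f
      & induced_by Omega (qconj (R:=R) \o E0) (qconj (R:=R) \o E1) (slice_conj Omega f)].
  apply: (@xgetPex _ f [set h | exists E0 E1,
    [/\ regular_stem Omega E0 E1, induced_by Omega E0 E1 f
      & induced_by Omega (qconj (R:=R) \o E0) (qconj (R:=R) \o E1) h]]).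
  exists (from_stem (qconj (R:=R) \o F0) (qconj (R:=R) \o F1)), F0, F1.
  by split => //; exact: from_stemP.
have [e0 e1] : F0 z = E0 z /\ F1 z = E1 z.
  apply: stem_inj => J Ju.
  by rewrite -(induced_all circ Find Dz Ju) (induced_all circ Eind Dz Ju).
by rewrite (induced_all circ cind Dz Iu) /= e0 e1.
Qed.

(** The norm of an element of the complexified quaternions given by its four complex
   coordinates: the stem of the symmetrized function. *)
Definition nform (f : nat -> C -> C) (c : C) : C := \sum_(k < 4) f k c ^+ 2.

Lemma symmetrizedE Omega F0 F1 f z I : circular Omega -> regular_stem Omega F0 F1 ->
  induced_by Omega F0 F1 f -> imag_units I -> stem_dom Omega z ->
  symmetrized Omega f (slice_pt I z) = slice_pt I (rpt (nform (stem_comp F0 F1) (cpt z))).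
Proof.
move=> circ Freg Find Iu Dz.
have cE J : imag_units J ->
    slice_conj Omega f (slice_pt J z) = qconj (F0 z) + J * qconj (F1 z).
  by move=> Ju; exact: slice_conjE.
rewrite /symmetrized (star_stem Iu (induced_all circ Find Dz Iu) cE).
rewrite /slice_pt /nform !big_ord_recr big_ord0 /= /stem_comp cptK.
have -> (x : R) : x *: I = I * x%:A by rewrite -scalerAr mulr1.
congr (_ + _ * _); apply: quatP; rewrite !qcoord_conj !qcoordE /=; ring.
Qed.

(** Two distinct slices meet in the real axis. *)
Lemma in_all_planes q : (forall I, imag_units I -> slice_plane I q) ->
  q = (qcoord q 0)%:A.
Proof.
move=> plane.
have Iu : imag_units (mkquat 0 1 0 0 : quat R).
  by apply/imag_unitsP; rewrite !qcoordE; split => //; ring.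
have Ju : imag_units (mkquat 0 0 1 0 : quat R).
  by apply/imag_unitsP; rewrite !qcoordE; split => //; ring.
have [z _ zq] := plane _ Iu; have [w _ wq] := plane _ Ju.
have q1 : qcoord q 1 = 0 by rewrite -wq /slice_pt !qcoordE; ring.
have q2 : qcoord q 2 = 0 by rewrite -zq /slice_pt !qcoordE; ring.
have q3 : qcoord q 3 = 0 by rewrite -zq /slice_pt !qcoordE; ring.
by apply: quatP; rewrite !qcoordZ !qcoord1 ?q1 ?q2 ?q3; ring.
Qed.

(** The values at [I] and [- I] both lie in the plane of [I], and so do the two parts
   of the stem, for every [I]. *)
Lemma slice_preserving_real Omega T0 T1 f z : circular Omega ->
  slice_preserving Omega f -> induced_by Omega T0 T1 f -> stem_dom Omega z ->
  T0 z = (qcoord (T0 z) 0)%:A /\ T1 z = (qcoord (T1 z) 0)%:A.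
Proof.
move=> circ [_ pres] ind Dz.
have plane I : imag_units I -> slice_plane I (T0 z + I * T1 z).
  move=> Iu; rewrite -(induced_all circ ind Dz Iu); apply: pres => //.
  exists (slice_pt I z) => //; split; first exact: stem_dom_slice.
  by exists z.
have both I : imag_units I -> slice_plane I (T0 z) /\ slice_plane I (I * T1 z).
  move=> Iu; have [v _ vE] := plane _ Iu; have [w _ wE] := plane _ (imag_unitsN Iu).
  have k1 i := congr1 (fun q => qcoord q i) vE.
  have k2 i := congr1 (fun q => qcoord q i) wE.
  split; [exists ((v.1 + w.1) / 2, (v.2 - w.2) / 2) => //|
          exists ((v.1 - w.1) / 2, (v.2 + w.2) / 2) => //];
  (apply: quatP; [move: (k1 0%N) (k2 0%N)|move: (k1 1%N) (k2 1%N)|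
    move: (k1 2%N) (k2 2%N)|move: (k1 3%N) (k2 3%N)]);
  rewrite /slice_pt mulNr !(qcoordD, qcoordN, qcoordZ, qcoord1) /=; lra.
split; apply: in_all_planes => I Iu; first exact: (both I Iu).1.
have [v _ vE] := (both I Iu).2; exists (v.2, - v.1) => //.
have II : I * I = -1 by rewrite -expr2; exact: Iu.
have -> : T1 z = - (I * (I * T1 z)) by rewrite mulrA II mulN1r opprK.
rewrite -vE /slice_pt /= mulrDr -!scalerAr II mulr1 scalerN opprD opprK.
by rewrite addrC scaleNr.
Qed.

Lemma real_stemE Omega T0 T1 f z I : circular Omega ->
  slice_preserving Omega f -> induced_by Omega T0 T1 f -> stem_dom Omega z ->
  imag_units I ->
  f (slice_pt I z) = slice_pt I (rpt (stem_comp T0 T1 0 (cpt z))).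
Proof.
move=> circ pres ind Dz Iu; have [t0 t1] := slice_preserving_real circ pres ind Dz.
rewrite (induced_all circ ind Dz Iu) {1}t0 {1}t1 /stem_comp cptK /slice_pt /=.
by rewrite -scalerAr mulr1.
Qed.

Lemma real_stem_nform Omega T0 T1 f z : circular Omega ->
  slice_preserving Omega f -> induced_by Omega T0 T1 f -> stem_dom Omega z ->
  nform (stem_comp T0 T1) (cpt z) = stem_comp T0 T1 0 (cpt z) ^+ 2.
Proof.
move=> circ pres ind Dz; have [t0 t1] := slice_preserving_real circ pres ind Dz.
rewrite /nform !big_ord_recr big_ord0 /= /stem_comp cptK t0 t1.
rewrite !(qcoordZ, qcoord1) /= !(mulr0, mulr1) add0r.
by rewrite !expr2 !mulr0 !addr0.
Qed.

(** If the stem is [a0 + i a1] with [a1] nonzero, the vanishing of the norm form says that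
   [a0] and [a1] are orthogonal of equal length, so that [- a0 / a1] is an imaginary
   unit. *)
Lemma null_stem (F0 F1 : R * R -> quat R) c : nform (stem_comp F0 F1) c = 0 ->
  exists2 I, imag_units I & F0 (rpt c) + I * F1 (rpt c) = 0.
Proof.
rewrite /nform !big_ord_recr big_ord0 /= /stem_comp => n0.
move: (congr1 (@complex.Re R) n0) (congr1 (@complex.Im R) n0) => {n0}.
rewrite !expr2 /=; move: (F0 (rpt c)) (F1 (rpt c)) => a b re im.
have nab : qnorm a ^+ 2 = qnorm b ^+ 2 by rewrite !qnorm_sqr !expr2; lra.
have [b0|b0] := eqVneq b 0.
  have a0 : a == 0 by rewrite -qnorm_eq0 nab b0 qnorm_eq0.
  by have [I Iu] := exists_imag R; exists I => //; rewrite (eqP a0) b0 mulr0 addr0.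
have r0 : qnorm b ^+ 2 != 0 by rewrite qnorm_eq0.
exists (- (a * b^-1)); last by rewrite mulNr -mulrA mulVr // mulr1 subrr.
have -> : b^-1 = (qnorm b ^+ 2)^-1 *: qconj b.
  by rewrite -[LHS]/(Defs.invq b) /Defs.invq (negbTE b0).
apply/imag_unitsP; rewrite -scalerAr !(qcoordN, qcoordZ).
have orth : qcoord (a * qconj b) 0 = 0 by rewrite qcoordM qcoord_conj !qcoord_mk; lra.
rewrite orth mulr0 oppr0; split => //.
have sq : qcoord (a * qconj b) 1 ^+ 2 + qcoord (a * qconj b) 2 ^+ 2
    + qcoord (a * qconj b) 3 ^+ 2 = qnorm a ^+ 2 * qnorm b ^+ 2.
  have : qcoord (a * qconj b) 0 ^+ 2 + (qcoord (a * qconj b) 1 ^+ 2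
    + qcoord (a * qconj b) 2 ^+ 2 + qcoord (a * qconj b) 3 ^+ 2) =
      qnorm a ^+ 2 * qnorm b ^+ 2.
    by rewrite !qnorm_sqr !qcoordM !qcoord_conj !qcoord_mk; ring.
  by rewrite orth expr0n add0r.
rewrite !sqrrN ![(_^-1 * _) ^+ 2]exprMn -!mulrDr sq nab.
by rewrite -[qnorm b ^+ 2 * _]expr2 -exprMn mulVf // expr1n.
Qed.

Lemma stem_mul Omega F0 F1 G0 G1 f g (d : C -> C) z : circular Omega ->
  induced_by Omega F0 F1 f -> induced_by Omega G0 G1 g -> stem_dom Omega z ->
  (forall I, imag_units I ->
     g (slice_pt I z) = slice_pt I (rpt (d (cpt z))) * f (slice_pt I z)) ->
  forall k, stem_comp G0 G1 k (cpt z) = d (cpt z) * stem_comp F0 F1 k (cpt z).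
Proof.
move=> circ indf indg Dz gE k.
have [e0 e1] : G0 z = complex.Re (d (cpt z)) *: F0 z - complex.Im (d (cpt z)) *: F1 z /\
    G1 z = complex.Re (d (cpt z)) *: F1 z + complex.Im (d (cpt z)) *: F0 z.
  apply: stem_inj => I Iu.
  rewrite -(induced_all circ indg Dz Iu) gE // (induced_all circ indf Dz Iu).
  exact: slice_mul_stem.
rewrite /stem_comp cptK e0 e1; case: (d _) => x y /=.
by rewrite !(qcoordD, qcoordN, qcoordZ).
Qed.

Lemma nformM (f g : nat -> C -> C) d c : (forall k, (k < 4)%N -> g k c = d * f k c) ->
  nform g c = d ^+ 2 * nform f c.
Proof.
move=> gf; rewrite /nform mulr_sumr; apply: eq_bigr => k _.
by rewrite gf // exprMn.
Qed.

Lemma nform_hol (A : set C) (f : nat -> C -> C) :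
  (forall k, (k < 4)%N -> hol A (f k)) -> hol A (nform f).
Proof.
move=> fh; apply: (@hol_sum _ A _ (index_enum 'I_4) (fun k c => f k c ^+ 2)) => k.
by apply: holX; exact: fh.
Qed.

End StemAlgebra.

(** * Quotients of holomorphic functions *)

Section LocalQuotient.
Variable R : realType.
Local Notation C := R[i].
Variables (D : set C) (t : C -> C) (G : nat -> C -> C).
Hypothesis D_open : forall c, D c -> cnbhs c D.
Hypothesis G_hol : forall k, (k < 4)%N -> hol D (G k).

(** Off the zeroes of [t] the quotient is forced; the zeroes being isolated, each local
   quotient agrees with it near its centre. *)
Lemma glue_quotient :
  (forall c, D c -> cdnbhs c [set z | t z != 0]) ->
  (forall c, D c -> exists W : nat -> C -> C, forall k, (k < 4)%N ->
     (exists l, sdiff (W k) c l) /\ cnbhs c [set z | t z * W k z = G k z]) ->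
  exists2 H : nat -> C -> C, forall k, (k < 4)%N -> hol D (H k) &
    forall k c, (k < 4)%N -> D c -> t c * H k c = G k c.
Proof.
move=> t0 loc.
have /choice[W WP] : forall c, exists W : nat -> C -> C, D c -> forall k, (k < 4)%N ->
     (exists l, sdiff (W k) c l) /\ cnbhs c [set z | t z * W k z = G k z].
  move=> c; have [Dc|nD] := pselect (D c); last by exists (fun _ _ => 0).
  by have [W WP] := loc c Dc; exists W.
pose H k c := if t c == 0 then W c k c else G k c / t c.
exists H => [k k4 c Dc|k c k4 Dc]; last first.
  rewrite /H; case: eqVneq => [tc|tc]; last by rewrite mulrC divfK.
  by have [_ /cnbhs_at] := WP c Dc k k4.
have [[l Wl] tW] := WP c Dc k k4; exists l; apply: sdiff_near Wl.
have t0c : cnbhs c [set z | z != c -> t z != 0] := t0 c Dc.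
apply: filterS2 t0c (tW) => z /= tz tWz; rewrite /H.
have [->|zc] := eqVneq z c.
  case: eqVneq => // tc; apply: (mulfI tc); rewrite [RHS]mulrC divfK //.
  exact: cnbhs_at tW.
by rewrite (negbTE (tz zc)) -tWz mulrAC divff ?mul1r // tz.
Qed.

(** The identity holds where [t] does not vanish and extends by continuity. *)
Lemma quotient_conj (H : nat -> C -> C) k c : (k < 4)%N ->
  (forall z, D z -> D z^*) ->
  (forall z, D z -> cdnbhs z [set w | t w != 0]) ->
  (forall z, D z -> t z^* = (t z)^*) -> (forall z, D z -> G k z^* = (G k z)^*) ->
  hol D (H k) -> (forall z, D z -> t z * H k z = G k z) ->
  D c -> H k c^* = (H k c)^*.
Proof.
move=> k4 Dconj t0 tconj Gconj Hh tH Dc.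
have cont1 := hol_cont Hh Dc; have cont2 := hol_cont Hh (Dconj _ Dc).
have c1 : ccont (fun z => (H k z^*)^*) c.
  have h : clim (cnbhs c) (fun z => H k z^*) (H k c^*).
    move=> e /cont2[d d0 dP]; exists d => // z zd; apply: dP.
    by rewrite /disc /= -rmorphB normc_conj.
  exact: clim_conj h.
have -> : H k c = (H k c^*)^*; last by rewrite conjcK.
apply: ccont_eq_dnbhs cont1 c1 _.
apply: filterS2 (t0 _ Dc) (cdnbhs_le (D_open Dc)) => z /= tz Dz.
apply: (mulfI tz); rewrite tH //; apply: (can_inj (@conjcK R)).
rewrite rmorphM /= conjcK -tconj // -Gconj // tH //; exact: Dconj.
Qed.

(** On the real axis [t ^+ 2] is a sum of squares of real numbers, hence [G k] is bounded
   by [t] and vanishes there to at least the same order. *)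
Lemma division_real (U : C -> C) (x0 : R) (p : nat) k : (k < 4)%N -> D x0%:C ->
  ccont U x0%:C -> (forall z, t z = (z - x0%:C) ^+ p * U z) ->
  (forall z, D z -> nform G z = t z ^+ 2) ->
  (forall x : R, D x%:C -> complex.Im (t x%:C) = 0) ->
  (forall i (x : R), (i < 4)%N -> D x%:C -> complex.Im (G i x%:C) = 0) ->
  exists2 V, hol D V & forall z, G k z = (z - x0%:C) ^+ p * V z.
Proof.
move=> k4 Dx0 Uc tU Gt t_real G_real.
have [r r0 rD] := D_open Dx0.
have le_Gt (x : R) : D x%:C -> normc (G k x%:C) <= normc (t x%:C).
  move=> Dx; have gr i : (i < 4)%N -> G i x%:C = (complex.Re (G i x%:C))%:C.
    by move=> i4; apply/eqP; rewrite eq_complex /= eqxx G_real ?eqxx.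
  have tr : t x%:C = (complex.Re (t x%:C))%:C.
    by apply/eqP; rewrite eq_complex /= eqxx t_real ?eqxx.
  have := Gt _ Dx; rewrite tr gr // !normc_real /nform -rmorphXn.
  under eq_bigr => i _ do rewrite gr // -rmorphXn.
  rewrite -rmorph_sum => /complexI sq.
  rewrite -(ler_pXn2r (ltn0Sn 1)) ?nnegrE // !real_normK ?num_real // -sq.
  rewrite (bigD1 (Ordinal k4)) //= lerDl.
  by apply: sumr_ge0 => i _; exact: sqr_ge0.
have key j : (j <= p)%N -> exists2 V, hol D V & forall z, G k z = (z - x0%:C) ^+ j * V z.
  elim: j => [_|j ih jp]; first by exists (G k); [exact: G_hol|move=> z; rewrite mul1r].
  have [V Vh GV] := ih (ltnW jp).
  suff V0 : V x0%:C = 0.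
    have [W Wh VW] := division r0 rD Vh V0.
    by exists W => // z; rewrite GV VW exprSr mulrA.
  apply: normc_small_eq0 => e e0; have e20 : 0 < e / 2 by lra.
  pose M := normc (U x0%:C) + 1.
  have M0 : 0 < M by rewrite /M; have := normc_ge0 (U x0%:C); lra.
  have nV := hol_cont Vh Dx0 e20.
  have nU := Uc _ ltr01.
  have [d d0 dP] := filterI (filterI nV nU) (D_open Dx0).
  (* The point [x0 + s] lies on the real axis, close enough to [x0]. *)
  pose s := Num.min (d / 2) (Num.min 1 (e / 2 / M)).
  have s0 : 0 < s.
    have h1 : 0 < d / 2 by lra.
    have h2 : 0 < e / 2 / M by rewrite divr_gt0.
    by rewrite /s !lt_min h1 h2 ltr01.
  have sd : s <= d / 2 by rewrite /s ge_min lexx.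
  have s1 : s <= 1 by rewrite /s !ge_min lexx orbT.
  have sM : s * M <= e / 2 by rewrite -ler_pdivlMr // /s !ge_min lexx !orbT.
  have xE : (x0 + s)%:C - x0%:C = s%:C by rewrite rmorphD addrAC subrr add0r.
  have [[/= hV hU] Dx] : ([set z | normc (V z - V x0%:C) <= e / 2] `&`
      [set z | normc (U z - U x0%:C) <= 1] `&` D) (x0 + s)%:C.
    by apply: dP; rewrite /disc /mkset xE normc_real gtr0_norm //; lra.
  have := le_Gt _ Dx; rewrite tU GV xE !normcM !normcX normc_real gtr0_norm //.
  rewrite -(subnKC jp) exprD exprSr -!mulrA ler_pM2l ?exprn_gt0 // => hx.
  have UM : normc (U (x0 + s)%:C) <= M.
    have := ler_normcD (U (x0 + s)%:C - U x0%:C) (U x0%:C).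
    by rewrite subrK /M; lra.
  have sp : s ^+ (p - j.+1) <= 1 by rewrite exprn_ile1 // ltW.
  have hx2 : s ^+ (p - j.+1) * normc (U (x0 + s)%:C) <= M.
    by rewrite -[M]mul1r ler_pM ?normc_ge0 ?exprn_ge0 // ltW.
  have hx3 : s * (s ^+ (p - j.+1) * normc (U (x0 + s)%:C)) <= s * M by rewrite ler_pM2l.
  have := ler_distc (V (x0 + s)%:C) (V x0%:C) 0; rewrite !subr0 distcC.
  lra.
exact: key.
Qed.

End LocalQuotient.

(** * Slice preserving functions and the polynomial Delta *)

Section SlicePreserving.
Variable R : realType.
Local Notation C := R[i].
Implicit Types (Omega : set (quat R)) (I J q : quat R).

Lemma cdom_conj Omega (c : C) : circular Omega -> cdom Omega c -> cdom Omega c^*.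
Proof.
move=> circ Dc; have [I Iu] := exists_imag R; exists I => //.
have -> : rpt c^* = ((rpt c).1, - (rpt c).2) by case: c {Dc}.
by rewrite -slice_ptN; apply: stem_dom_slice Dc => //; exact: imag_unitsN.
Qed.

Lemma stem_comp_conj Omega F0 F1 k (c : C) : stem_parity Omega F0 F1 -> cdom Omega c ->
  stem_comp F0 F1 k c^* = (stem_comp F0 F1 k c)^*.
Proof.
move=> par /par; have -> : ((rpt c).1, - (rpt c).2) = rpt c^* by case: c.
by rewrite /stem_comp => -[-> ->]; rewrite qcoordN.
Qed.

Lemma qconj_real (x : R) : qconj (x%:A : quat R) = x%:A.
Proof. by apply: quatP; rewrite qcoord_conj !qcoordE; ring. Qed.

(** Two quaternions of one slice commute. *)
Lemma slice_pt_conj I (c d : C) : imag_units I -> d != 0 ->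
  (slice_pt I (rpt d))^-1 * slice_pt I (rpt c) * slice_pt I (rpt d) = slice_pt I (rpt c).
Proof.
move=> Iu d0; rewrite -mulrA slice_ptM // mulrC -slice_ptM //.
have du : slice_pt I (rpt d) \is a GRing.unit.
  by change (slice_pt I (rpt d) != 0); rewrite slice_pt_eq0.
by rewrite mulrA mulVr ?mul1r.
Qed.

Section RealStem.
Variables (Omega : set (quat R)) (T0 T1 : R * R -> quat R) (tau : quat R -> quat R).
Hypotheses (circ : circular Omega) (Treg : regular_stem Omega T0 T1).
Hypotheses (Tind : induced_by Omega T0 T1 tau) (pres : slice_preserving Omega tau).
Let t := stem_comp T0 T1 0.

Lemma tauE I c : imag_units I -> cdom Omega c ->
  tau (slice_pt I (rpt c)) = slice_pt I (rpt (t c)).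
Proof. by move=> Iu Dc; rewrite (real_stemE circ pres Tind Dc Iu) rptK. Qed.

Lemma star_tau f I c : imag_units I -> cdom Omega c -> 
  star tau f (slice_pt I (rpt c)) = tau (slice_pt I (rpt c)) * f (slice_pt I (rpt c)).
Proof.
move=> Iu Dc; rewrite /star tauE // slice_pt_eq0 //.
case: eqVneq => [->|t0]; last by rewrite slice_pt_conj.
by rewrite /slice_pt /= !scale0r addr0 mul0r.
Qed.

Lemma star_inv_tau I c : imag_units I -> cdom Omega c -> t c != 0 ->
  star_inv Omega tau (slice_pt I (rpt c)) = (tau (slice_pt I (rpt c)))^-1.
Proof.
move=> Iu Dc t0; rewrite /star_inv (symmetrizedE circ Treg Tind Iu Dc).
rewrite rptK -{1}[c]rptK (real_stem_nform circ pres Tind Dc) rptK -/t.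
have [r0 r1] := slice_preserving_real circ pres Tind Dc.
rewrite (slice_conjE circ Treg Tind Iu Dc) r0 r1 !qconj_real -r0 -r1.
rewrite -(induced_all circ Tind Dc Iu) tauE // -slice_ptX //.
set s := slice_pt I (rpt (t c)).
have su : s \is a GRing.unit by change (s != 0); rewrite slice_pt_eq0.
by rewrite expr2 invrM // -mulrA mulVr // mulr1.
Qed.

Lemma star_tau_quotient g I c : imag_units I -> cdom Omega c -> t c != 0 ->
  star (star_inv Omega tau) g (slice_pt I (rpt c)) =
  (tau (slice_pt I (rpt c)))^-1 * g (slice_pt I (rpt c)).
Proof.
move=> Iu Dc t0; rewrite /star star_inv_tau // tauE //.
set s := slice_pt I (rpt (t c)).
have s0 : s != 0 by rewrite slice_pt_eq0.
have su : s \is a GRing.unit by exact: s0.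
have sV : s^-1 != 0 by rewrite -[s^-1 != 0]/(s^-1 \is a GRing.unit) unitrV.
rewrite (negbTE sV) invrK; congr (_ * g _).
by rewrite slice_ptM // mulrC -slice_ptM // -mulrA divrr // mulr1.
Qed.

End RealStem.

(** Over the complex plane [Delta] becomes the real polynomial whose roots are [c0] and
   its conjugate. *)
Lemma DeltaE I J (c c0 : C) : imag_units I -> imag_units J ->
  Delta (slice_pt J (rpt c0)) (slice_pt I (rpt c)) =
  slice_pt I (rpt ((c - c0) * (c - c0^*))).
Proof.
move=> Iu Ju; rewrite /Delta slice_ptX // slice_pt_re //.
have -> : qnorm (slice_pt J (rpt c0)) ^+ 2 = (rpt c0).1 ^+ 2 + (rpt c0).2 ^+ 2.
  move/imag_unitsP: Ju => [J0 J1]; rewrite qnorm_sqr /slice_pt !qcoordE J0.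
  transitivity ((rpt c0).1 ^+ 2 + (rpt c0).2 ^+ 2 *
    (qcoord J 1 ^+ 2 + qcoord J 2 ^+ 2 + qcoord J 3 ^+ 2)); first by ring.
  by rewrite J1 mulr1.
move/imag_unitsP: Iu => [I0 I1]; case: c c0 => [a b] [a0 b0].
by apply: quatP; rewrite expr2 /slice_pt !qcoordE /= ?I0; ring.
Qed.

End SlicePreserving.

(** * The identity theorem on a circular domain *)

Section Identity.
Variable R : realType.
Local Notation C := R[i].
Implicit Types (Omega : set (quat R)) (q : quat R).

(** The point of the closed upper half plane that represents the sphere of [q]. *)
Definition halfplane_pt q : C := qre q +i* qnorm (qim q).

Lemma halfplane_pt_near q (P : set C) : cnbhs (halfplane_pt q) P ->
  nbhs q [set p | P (halfplane_pt p)].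
Proof.
have imE (p : quat R) : qnorm (qim p) = Num.sqrt (qcoord p 1 * qcoord p 1 +
    qcoord p 2 * qcoord p 2 + qcoord p 3 * qcoord p 3).
  rewrite -[LHS](ger0_norm (sqrtr_ge0 _)) -sqrtr_sqr qnorm_sqr.
  by congr Num.sqrt; rewrite /qim /qre !qcoordE; ring.
have sq_cvg k : qcoord p k * qcoord p k @[p --> q] --> qcoord q k * qcoord q k.
  have c : qcoord p k @[p --> q] --> qcoord q k := @qcoord_continuous _ k q.
  have := cvgM c c; exact.
have sum_cvg :
  qcoord p 1 * qcoord p 1 + qcoord p 2 * qcoord p 2 + qcoord p 3 * qcoord p 3 @[p --> q]
    --> qcoord q 1 * qcoord q 1 + qcoord q 2 * qcoord q 2 + qcoord q 3 * qcoord q 3.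
  have := cvgD (cvgD (sq_cvg 1%N) (sq_cvg 2%N)) (sq_cvg 3%N); exact.
have im_cvg : qnorm (qim p) @[p --> q] --> qnorm (qim q).
  rewrite imE (_ : (fun p => _) = (fun p => Num.sqrt (qcoord p 1 * qcoord p 1 +
    qcoord p 2 * qcoord p 2 + qcoord p 3 * qcoord p 3))); last exact/funext.
  have := continuous_cvg _ (@sqrt_continuous R _) sum_cvg; exact.
have re_cvg : qre p @[p --> q] --> qre q := @qcoord_continuous _ 0%N q.
move=> hP; have pair_cvg : (qre p, qnorm (qim p)) @[p --> q] --> (qre q, qnorm (qim q)).
  exact: (cvg_pair re_cvg im_cvg).
exact: (pair_cvg _ (cnbhs_nbhs (z := (qre q, qnorm (qim q))) hP)).
Qed.

(** The stem domain may consist of two components exchanged by conjugation, so that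
   the connectedness used is that of [Omega] itself: the points over which [t]
   vanishes identically nearby form an open and closed subset. *)
Lemma identity_theorem Omega (t : C -> C) : circular_domain Omega ->
  hol (cdom Omega) t -> (forall c, cdom Omega c -> t c^* = (t c)^*) ->
  (exists2 c, cdom Omega c & t c != 0) ->
  forall c, cdom Omega c -> ~ cnbhs c [set z | t z = 0].
Proof.
move=> [_ Oo Oc circ] th tconj [c1 Dc1 tc1] c Dc tc0.
pose Z : set (quat R) := [set q | cnbhs (halfplane_pt q) [set z | t z = 0]].
have DO q : Omega q -> cdom Omega (halfplane_pt q).
  by move=> Oq; have [I Iu qE] := slice_repr q; exists I; rewrite // -qE.
have Zconj d : cdom Omega d -> cnbhs d [set z | t z = 0] -> cnbhs d^* [set z | t z = 0].
  move=> Dd td0; have [r r0 rP] := filterI td0 (cdom_near Oo Dd).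
  exists r => // z zd /=; have [/= tz Dz] : ([set z | t z = 0] `&` cdom Omega) z^*.
    by apply: rP; move: zd; rewrite /disc /= -{1}[z]conjcK -rmorphB normc_conj.
  by rewrite -[z]conjcK tconj // tz rmorph0.
have upper d : cdom Omega d ->
    exists2 q, Omega q & halfplane_pt q = d \/ halfplane_pt q = d^*.
  move=> Dd; have [I Iu] := exists_imag R; exists (slice_pt I (rpt d)).
    exact: stem_dom_slice.
  rewrite /halfplane_pt slice_pt_re // slice_pt_norm_im //.
  case: d {Dd} => a b /=; have [b0|b0] := leP 0 b; [left|right].
    by rewrite ger0_norm.
  by rewrite ltr0_norm.
have OZ : Omega = Omega `&` Z.
  apply/esym/Oc.
  - have [q Oq qc] := upper c Dc; exists q; split => //; rewrite /Z /=.
    by case: qc => ->; [exact: tc0|exact: Zconj].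
  - exists Z => //; rewrite openE => q Zq.
    exact: halfplane_pt_near (cnbhs_near Zq).
  - exists (closure (Omega `&` Z)); first exact: closed_closure.
    apply/seteqP; split=> [q [Oq Zq]|q [Oq qcl]]; split => //.
      exact: subset_closure.
    have [r r0 rD] := cdom_near Oo (DO q Oq).
    have r16 : 0 < r / 16 by rewrite divr_gt0.
    have [p [[Op Zp] pq]] := qcl _ (halfplane_pt_near (cnbhs_disc (halfplane_pt q) r16)).
    have r2 : 0 < r / 2 by rewrite divr_gt0.
    have th2 : hol (disc (halfplane_pt p) (r / 2)) t.
      apply: hol_sub th => z zp; apply: rD; move: zp pq; rewrite /disc /mkset => zp pq.
      by apply: le_lt_trans (ler_distc (halfplane_pt p) _ _) _; lra.
    have := identity_disc r2 th2 Zp => t0.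
    exists (r / 16) => // z zq; apply: t0; move: zq pq; rewrite /disc /mkset => zq pq.
    apply: le_lt_trans (ler_distc (halfplane_pt q) _ _) _.
    by rewrite [normc (halfplane_pt q - _)]distcC; lra.
have ZO q : Omega q -> Z q by rewrite {1}OZ => -[].
have [q Oq qc] := upper c1 Dc1.
have := cnbhs_at (ZO q Oq); rewrite /=.
case: qc => ->; first by move=> h; rewrite h eqxx in tc1.
by rewrite tconj // => /eqP; rewrite conjc_eq0 (negbTE tc1).
Qed.

End Identity.

(** * The quotient by a square root of the symmetrized function *)

Section Quotient.
Variable R : realType.
Local Notation C := R[i].
Implicit Types (I J q : quat R).
Variables (Omega : set (quat R)) (g tau : quat R -> quat R).
Variables (G0 G1 T0 T1 : R * R -> quat R).
Hypotheses (dom : circular_domain Omega).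
Hypotheses (Greg : regular_stem Omega G0 G1) (Gind : induced_by Omega G0 G1 g).
Hypotheses (Treg : regular_stem Omega T0 T1) (Tind : induced_by Omega T0 T1 tau).
Hypothesis pres : slice_preserving Omega tau.
Hypothesis tau_neq0 : exists2 q, Omega q & tau q != 0.
Hypothesis square : forall q, Omega q -> star tau tau q = symmetrized Omega g q.
Hypothesis no_zero : forall q0 : quat R, ~ nonreal_isolated_zero Omega g q0.

Let D := cdom Omega.
Let G := stem_comp G0 G1.
Let t := stem_comp T0 T1 0.

Let Oopen : open Omega. Proof. by case: dom. Qed.
Let circ : circular Omega. Proof. by case: dom. Qed.

Let G_hol k : hol D (G k).
Proof. exact: stem_hol. Qed.

Let t_hol : hol D t.
Proof. exact: stem_hol. Qed.

Let D_open c : D c -> cnbhs c D.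
Proof. exact: cdom_near. Qed.

Let D_slice I c : imag_units I -> D c -> Omega (slice_pt I (rpt c)).
Proof. by move=> Iu Dc; exact: stem_dom_slice. Qed.

Let t_conj c : D c -> t c^* = (t c)^*.
Proof. by apply: stem_comp_conj; case: Treg. Qed.

Let G_conj k c : D c -> G k c^* = (G k c)^*.
Proof. by apply: stem_comp_conj; case: Greg. Qed.

Let tau_t I c : imag_units I -> D c -> tau (slice_pt I (rpt c)) = slice_pt I (rpt (t c)).
Proof. exact: tauE. Qed.

Let square_t c : D c -> nform G c = t c ^+ 2.
Proof.
move=> Dc; have [I Iu] := exists_imag R; have Oq := D_slice Iu Dc.
have := square Oq; rewrite (star_tau circ Tind pres) // tau_t // slice_ptM //.
rewrite (symmetrizedE circ Greg Gind Iu Dc) rptK => /(slice_pt_inj Iu) h.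
by rewrite -[nform G c]rptK -h rptK expr2.
Qed.

Let slice_cdom q : Omega q -> exists I c, [/\ imag_units I, D c & q = slice_pt I (rpt c)].
Proof.
move=> Oq; have [I Iu qE] := slice_repr q.
exists I, (cpt (qre q, qnorm (qim q))); rewrite cptK; split => //.
by exists I => //; rewrite cptK -qE.
Qed.

Let t_neq0 : forall c, D c -> ~ cnbhs c [set z | t z = 0].
Proof.
apply: identity_theorem => //.
have [q Oq tq] := tau_neq0; have [I [c [Iu Dc qE]]] := slice_cdom Oq.
by exists c => //; move: tq; rewrite qE tau_t // slice_pt_eq0.
Qed.

Let t_order c : D c ->
  exists p U, [/\ hol D U, U c != 0 & forall z, t z = (z - c) ^+ p * U z].
Proof.
move=> Dc; have [r r0 rD] := D_open Dc.
have [//|vanish] := order_or_vanish r0 rD t_hol.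
exfalso; apply: (t_neq0 Dc); exists (r / 4); first by rewrite divr_gt0.
exact: vanish.
Qed.

Let t_dnbhs c : D c -> cdnbhs c [set z | t z != 0].
Proof.
move=> Dc; have [p [U [Uh Uc tU]]] := t_order Dc.
have := order_neq0 p (hol_cont Uh Dc) Uc; apply: (@filterS _ (cdnbhs c)) => z /=.
by rewrite tU.
Qed.

Section NonReal.
Variables (c0 : C) (p : nat) (U : C -> C).
Hypotheses (Dc0 : D c0) (c0_im : complex.Im c0 != 0).
Hypotheses (U_hol : hol D U) (U0 : U c0 != 0).
Hypothesis tU : forall z, t z = (z - c0) ^+ p * U z.

Let factorE m ft I E0 E1 k z : Delta_factor Omega (slice_pt I (rpt c0)) g m ft ->
  imag_units I -> induced_by Omega E0 E1 ft -> D z ->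
  G k z = (z - c0) ^+ m * ((z - c0^*) ^+ m * stem_comp E0 E1 k z).
Proof.
move=> [_ gE] Iu Eind Dz.
rewrite mulrA -exprMn -[z]rptK.
apply: (stem_mul (d := fun z => ((z - c0) * (z - c0^*)) ^+ m) circ Eind Gind Dz).
move=> J Ju; rewrite gE; last exact: D_slice.
by rewrite DeltaE // slice_ptX // rptK.
Qed.

Let squareE m (E : nat -> C -> C) :
  (forall k z, D z -> G k z = (z - c0) ^+ m * ((z - c0^*) ^+ m * E k z)) ->
  cdnbhs c0 [set z | (z - c0) ^+ (2 * p) * U z ^+ 2 =
    (z - c0) ^+ (2 * m) * ((z - c0^*) ^+ (2 * m) * nform E z)].
Proof.
move=> GE; apply: cdnbhs_le; apply: filterS (D_open Dc0) => z Dz /=.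
rewrite mulnC exprM -exprMn -tU -square_t //.
rewrite (@nformM _ E G ((z - c0) ^+ m * (z - c0^*) ^+ m)); last first.
  by move=> k _; rewrite GE // mulrA.
by rewrite exprMn -!exprM mulrA !(mulnC m).
Qed.

Let cont_nform (E : nat -> C -> C) m : (forall k, (k < 4)%N -> hol D (E k)) ->
  ccont (fun z => (z - c0^*) ^+ (2 * m) * nform E z) c0.
Proof.
move=> Eh; apply: climM.
  by apply: climX; exact: climD (ccont_id c0) (clim_cst _ (- c0^*)).
exact: hol_cont (nform_hol Eh) Dc0.
Qed.

Let cont_U2 : ccont (fun z => U z ^+ 2) c0.
Proof. exact: climX (hol_cont U_hol Dc0). Qed.

(** Let [E] be the components of [g] after the largest power [m] of [Delta] has been
   removed; [m] exists since it is at most the order of [t].  If the norm form of [E]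
   vanished at [c0], the remaining factor would vanish somewhere on the sphere of [c0],
   and that point would be a non-real isolated zero.  Hence [t ^+ 2] vanishes at [c0]
   to the order [2 * m] exactly, and [t] has at most the order [m] of [g]. *)
Lemma division_nonreal : exists V : nat -> C -> C,
  forall k, (k < 4)%N -> hol D (V k) /\ forall z, D z -> G k z = (z - c0) ^+ p * V k z.
Proof.
have [J Ju] := exists_imag R.
pose Q m := exists ft, Delta_factor Omega (slice_pt J (rpt c0)) g m ft.
have DeltaJ I : imag_units I -> Delta (slice_pt I (rpt c0)) =1 Delta (slice_pt J (rpt c0)).
  move=> Iu q; have [K Ku ->] := slice_repr q.
  by rewrite -[X in slice_pt K X]cptK !DeltaE.
have Qle m : Q m -> (m <= p)%N.
  move=> [ft Qm]; have [[E0 [E1 [Ereg Eind]]] _] := Qm.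
  rewrite leqNgt; apply/negP => pm.
  have GE k z : D z -> G k z = (z - c0) ^+ m * ((z - c0^*) ^+ m * stem_comp E0 E1 k z).
    exact: factorE Qm Ju Eind.
  have Eh k : (k < 4)%N -> hol D (stem_comp E0 E1 k) by move=> _; exact: stem_hol.
  have pm2 : (2 * p < 2 * m)%N by rewrite ltn_pmul2l.
  have := order_lt cont_U2 (cont_nform m Eh) pm2 (squareE GE).
  by move/eqP; rewrite expf_eq0 /= (negbTE U0).
have Q0 : exists m, `[< Q m >].
  exists 0%N; apply/asboolP; exists g; split; first by exists G0, G1.
  by move=> q _; rewrite expr0 mul1r.
have Qb m : `[< Q m >] -> (m <= p)%N by move/asboolP; exact: Qle.
have [m /asboolP[ft Qm] max_m] := ex_maxnP Q0 Qb.
have [[E0 [E1 [Ereg Eind]]] gft] := Qm.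
pose E := stem_comp E0 E1.
have GE k z : D z -> G k z = (z - c0) ^+ m * ((z - c0^*) ^+ m * E k z).
  exact: factorE Qm Ju Eind.
have Eh k : (k < 4)%N -> hol D (E k) by move=> _; exact: stem_hol.
have E_neq0 : nform E c0 != 0.
  apply/eqP => /null_stem[I Iu ftI0].
  apply: (no_zero (q0 := slice_pt I (rpt c0))); split.
  - have [q Oq tq] := tau_neq0; exists q => //; rewrite -square //.
    have [K [c [Ku Dc qE]]] := slice_cdom Oq.
    rewrite qE (star_tau circ Tind pres) // tau_t // slice_ptM // slice_pt_eq0 //.
    by rewrite mulf_neq0 //; move: tq; rewrite qE tau_t // slice_pt_eq0.
  - exact: D_slice.
  - by rewrite slice_pt_im // scaler_eq0 negb_or c0_im /= imag_units_neq0.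
  - exists m, ft; split.
    + split; first by exists E0, E1.
      by move=> q Oq; rewrite DeltaJ // gft.
    + move=> m' ft' [ft'reg gft']; apply: max_m; apply/asboolP; exists ft'; split => //.
      by move=> q Oq; rewrite gft' // DeltaJ.
    + by rewrite (induced_all circ Eind Dc0 Iu).
(* The other root of the polynomial of [Delta] does not interfere at [c0]. *)
have c0_conj : c0 - c0^* != 0.
  rewrite subr_eq0 eq_complex negb_and; apply/orP; right.
  case: (c0) c0_im => a b /=; apply: contra => /eqP bb.
  by apply/eqP; lra.
have pm : (p <= m)%N.
  rewrite leqNgt; apply/negP => mp.
  have mp2 : (2 * m < 2 * p)%N by rewrite ltn_pmul2l.
  have sq : cdnbhs c0 [set z | (z - c0) ^+ (2 * m) * ((z - c0^*) ^+ (2 * m) * nform E z) =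
      (z - c0) ^+ (2 * p) * U z ^+ 2].
    by apply: (@filterS _ (cdnbhs c0)) (squareE GE) => z /= ->.
  have := order_lt (cont_nform m Eh) cont_U2 mp2 sq.
  by move/eqP; rewrite mulf_eq0 expf_eq0 (negbTE c0_conj) andbF (negbTE E_neq0).
exists (fun k z => (z - c0) ^+ (m - p) * ((z - c0^*) ^+ m * E k z)) => k k4; split.
  apply: holM; [|apply: holM; [|exact: Eh]]; apply: holX;
    exact: (holD (@hol_id _ _) (@hol_cst _ _ _)).
by move=> z Dz; rewrite GE // [RHS]mulrA -exprD subnKC.
Qed.

End NonReal.

Lemma local_quotient c : D c -> exists W : nat -> C -> C, forall k, (k < 4)%N ->
  (exists l, sdiff (W k) c l) /\ cnbhs c [set z | t z * W k z = G k z].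
Proof.
move=> Dc; have [p [U [Uh Uc tU]]] := t_order Dc.
have [V VP] : exists V : nat -> C -> C, forall k, (k < 4)%N ->
    hol D (V k) /\ forall z, D z -> G k z = (z - c) ^+ p * V k z.
  have [c_im|c_im] := eqVneq (complex.Im c) 0; last exact: division_nonreal tU.
  have cE : c = (complex.Re c)%:C by apply/eqP; rewrite eq_complex /= c_im !eqxx.
  have real_im (f : C -> C) (x : R) : (D x%:C -> f (x%:C)^* = (f x%:C)^*) ->
      D x%:C -> complex.Im (f x%:C) = 0.
    move=> fc /fc; rewrite conjc_real => /(congr1 (@complex.Im R)).
    by case: (f _) => a b /=; lra.
  have /choice[V VP] : forall k, exists V : C -> C, (k < 4)%N ->
      hol D V /\ forall z, D z -> G k z = (z - c) ^+ p * V z.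
    move=> k; have [k4|k4] := ltnP k 4; last by exists (fun=> 0).
    rewrite cE in Dc Uc Uh tU *.
    have [V Vh GV] := @division_real R D t G D_open (fun k _ => @G_hol k) U (complex.Re c) p k
      k4 Dc (hol_cont Uh Dc) tU square_t (fun x => @real_im t x (@t_conj _))
      (fun i x _ => @real_im (G i) x (@G_conj i _)).
    by exists V => _; split => // z _.
  by exists V.
exists (fun k z => V k z * (U z)^-1) => k k4; have [Vh GV] := VP k k4.
have [l Vl] := Vh c Dc; have [m Um] := Uh c Dc.
split; first by eexists; exact: sdiffM Vl (sdiffV Um Uc).
apply: filterS2 (D_open Dc) (ccont_neq0 (hol_cont Uh Dc) Uc) => z Dz /= Uz.
by rewrite tU GV // mulrACA mulfV // mulr1.
Qed.

Lemma quotient_exists : exists h, regular_quotient Omega g tau h.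
Proof.
have [H Hh tH] := glue_quotient t_dnbhs local_quotient.
have Hconj k c : (k < 4)%N -> D c -> H k c^* = (H k c)^*.
  move=> k4; apply: (quotient_conj (t := t) (G := G) D_open k4) => //.
  - by move=> z; exact: cdom_conj.
  - exact: G_conj.
  - exact: Hh.
  - by move=> z; exact: tH.
have Hreg := hol_regular_stem Oopen Hh Hconj.
set H0 := qstem _ H in Hreg; set H1 := qstem (@complex.Im R) H in Hreg.
have Hind : induced_by Omega H0 H1 (from_stem H0 H1).
  by apply: from_stemP; case: Hreg.
exists (from_stem H0 H1); split; first by exists H0, H1.
move=> q Oq; have [I [c [Iu Dc ->]]] := slice_cdom Oq => tq.
have tu : tau (slice_pt I (rpt c)) \is a GRing.unit by exact: tq.
apply: (mulrI tu); rewrite mulrA divrr // mul1r tau_t //.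
rewrite (induced_all circ Hind Dc Iu) slice_mul_stem // (induced_all circ Gind Dc Iu).
have HG k : (k < 4)%N -> qcoord (G0 (rpt c)) k +i* qcoord (G1 (rpt c)) k =
    t c * (qcoord (H0 (rpt c)) k +i* qcoord (H1 (rpt c)) k).
  move=> k4; rewrite !qcoord_qstem // rptK.
  have -> : complex.Re (H k c) +i* complex.Im (H k c) = H k c by case: (H k c).
  by rewrite tH.
have HG0 k : (k < 4)%N -> qcoord (G0 (rpt c)) k = complex.Re (t c) * qcoord (H0 (rpt c)) k
    - complex.Im (t c) * qcoord (H1 (rpt c)) k.
  by move=> /HG /(congr1 (@complex.Re R)) /= ->; case: (t c).
have HG1 k : (k < 4)%N -> qcoord (G1 (rpt c)) k = complex.Re (t c) * qcoord (H1 (rpt c)) k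
    + complex.Im (t c) * qcoord (H0 (rpt c)) k.
  by move=> /HG /(congr1 (@complex.Im R)) /= ->; case: (t c).
by congr (_ + _ * _); apply: quatP; rewrite !(qcoordD, qcoordN, qcoordZ) ?HG0 ?HG1.
Qed.

(** Scaling by [t] multiplies the norm form by [t ^+ 2], so that the norm form of [h] is
   [1] off the zeroes of [t], and by continuity everywhere. *)
Lemma quotient_symmetrized h : regular_quotient Omega g tau h ->
  forall q, Omega q -> symmetrized Omega h q = 1.
Proof.
move=> [[H0 [H1 [Hreg Hind]]] hE].
have tH c : D c -> t c != 0 -> nform (stem_comp H0 H1) c = 1.
  move=> Dc tc; have GH k : G k c = t c * stem_comp H0 H1 k c.
    rewrite -[c]rptK; apply: (stem_mul circ Hind Gind Dc) => I Iu.
    rewrite rptK -tau_t // hE ?tau_t ?slice_pt_eq0 //; last exact: D_slice.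
    rewrite mulrA divrr ?mul1r //.
    by change (slice_pt I (rpt (t c)) != 0); rewrite slice_pt_eq0.
  have := nformM (fun k _ => GH k); rewrite square_t // => tt.
  by apply: (mulfI (expf_neq0 2 tc)); rewrite mulr1 -tt.
have H_hol : hol D (nform (stem_comp H0 H1)).
  by apply: nform_hol => k _; exact: stem_hol.
have nH c : D c -> nform (stem_comp H0 H1) c = 1.
  move=> Dc; have := ccont_eq_dnbhs (hol_cont H_hol Dc) (clim_cst (cnbhs c) 1); apply.
  have near_D : cdnbhs c D by apply: cdnbhs_le; exact: D_open.
  by apply: filterS2 near_D (t_dnbhs Dc) => z Dz tz; exact: tH.
move=> q Oq; have [I [c [Iu Dc ->]]] := slice_cdom Oq.
rewrite (symmetrizedE circ Hreg Hind Iu Dc) rptK nH //.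
by rewrite /slice_pt /= scale1r scale0r addr0.
Qed.

Lemma star_quotient q : Omega q -> tau q != 0 ->
  star (star_inv Omega tau) g q = (tau q)^-1 * g q.
Proof.
move=> Oq; have [I [c [Iu Dc ->]]] := slice_cdom Oq.
rewrite tau_t // slice_pt_eq0 // => tc.
by rewrite (star_tau_quotient circ Treg Tind pres) // tau_t.
Qed.

End Quotient.

Theorem proposition2p26 (R : realType) (Omega : set (quat R))
    (g tau : quat R -> quat R) :
  circular_domain Omega ->
  slice_regular Omega g ->
  (forall q0 : quat R, ~ nonreal_isolated_zero Omega g q0) ->
  slice_preserving Omega tau ->
  (exists2 q, Omega q & tau q != 0) ->
  (forall q, Omega q -> star tau tau q = symmetrized Omega g q) ->
  [/\ forall q, Omega q -> tau q != 0 ->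
        star (star_inv Omega tau) g q = (tau q)^-1 * g q,
      exists h, regular_quotient Omega g tau h
    & forall h, regular_quotient Omega g tau h ->
        forall q, Omega q -> symmetrized Omega h q = 1].
Proof.
move=> dom [G0 [G1 [Greg Gind]]] no_zero pres tau_neq0 square.
have [[T0 [T1 [Treg Tind]]] _] := pres.
split.
- by move=> q; exact: (star_quotient _ dom Treg Tind pres).
- exact: (quotient_exists dom Greg Gind Treg Tind pres tau_neq0 square no_zero).
- exact: (quotient_symmetrized dom Greg Gind Treg Tind pres tau_neq0 square).
Qed.
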